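(* Let $(M^n,g)$ be a closed connected Riemannian manifold of dimension $n$ whose Ricci curvature satisfies $-K_0\,g \leq \mathrm{Ric} \leq K_1\,g$ (as bilinear forms) for some constants $K_0, K_1 \geq 0$. Let $u_t(x)=u(x,t)$ be a smooth positive solution to the heat equation $\partial_t u_t = \Delta u_t$ on $M\times[0,\infty)$, with initial datum satisfying $u_0 \leq A$ for some constant $A>0$. Then $$ \frac{\Delta u_t}{u_t} \leq \frac{n}{t} +\left(\frac{5K_0}{1-e^{-2K_0t}} +2K_1\right) \log\left(\frac{A}{u_t}\right) \quad \text{on } M, \text{ for all } t > 0 . $$
   Context: Closed means compact without boundary. $\Delta = \mathrm{div}\circ\nabla$ is the Laplace--Beltrami operator of $(M,g)$ (so that $\Delta\phi$ is the trace of the Hessian of $\phi$). When $K_0=0$, the expression $\frac{5K_0}{1-e^{-2K_0t}}$ is understood as its limit for $K_0\to 0^+$, namely $\frac{5}{2t}$. *)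

(* Defs.v *)
From HB Require Import structures.
From mathcomp Require Import all_boot all_order all_algebra.
From mathcomp Require Import all_classical all_reals all_analysis.

Set Implicit Arguments.
Unset Strict Implicit.
Unset Printing Implicit Defensive.

Import Order.TTheory GRing.Theory Num.Theory.
Import numFieldNormedType.Exports.

Local Open Scope classical_set_scope.
Local Open Scope ring_scope.

(* Riemannian geometry in MathComp-Analysis, in classical local coordinates:
   a manifold is a topological space with a smooth atlas, a tensor field is
   given by its components in every chart of the atlas. *)

Section Smoothness.
Variables (R : realType) (V W : normedModType R).
Implicit Types (U A : set V) (f F : V -> W).

(* [:: v1; ..; vk] is sent to D_v1 (D_v2 (.. (D_vk f))). *)
Definition iter_derive (s : seq V) f : V -> W :=
  foldr (fun v (h : V -> W) => fun x => 'D_v h x) f s.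

(* C^oo on an open set U: in finite dimension, it amounts to the existence and
   continuity on U of the partial derivatives of all orders. *)
Definition smooth_in U f : Prop :=
  forall (s : seq V) (x : V), U x ->
    {for x, continuous (iter_derive s f)} /\
    (forall v, derivable (iter_derive s f) x v).

(* C^oo on a set A that need not be open, e.g. with boundary: local existence
   of a smooth extension. *)
Definition smooth_upto A f : Prop :=
  forall x, A x -> exists U F,
    [/\ open U, U x, smooth_in U F & forall y, (U `&` A) y -> F y = f y].

End Smoothness.

Section Manifolds.
Variables (R : realType) (n : nat).

(* The values of chart_map outside chart_dom, and of chart_inv outside
   chart_img, are irrelevant. *)
Record chart (M : topologicalType) := Chart {
  chart_dom : set M;
  chart_map : M -> 'rV[R]_n;
  chart_inv : 'rV[R]_n -> M;
  chart_img := chart_map @` chart_dom;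
  chart_dom_open : open chart_dom;
  chart_img_open : open chart_img;
  chart_mapK : forall p, chart_dom p -> chart_inv (chart_map p) = p;
  chart_map_continuous : {within chart_dom, continuous chart_map};
  chart_inv_continuous : {within chart_img, continuous chart_inv} }.

(* Smooth manifolds of dimension n, without boundary. The atlas need not be
   maximal. *)
Record manifold := Manifold {
  carrier :> topologicalType;
  manifold_hausdorff : hausdorff_space carrier;
  manifold_second_countable : @second_countable carrier;
  atlas : set (chart carrier);
  atlas_cover : forall p, exists c, atlas c /\ chart_dom c p;
  atlas_smooth : forall c c', atlas c -> atlas c' ->
    smooth_in (chart_map c @` (chart_dom c `&` chart_dom c'))
              (chart_map c' \o chart_inv c) }.

Definition chart_at (M : manifold) (p : M) : chart M :=
  sval (cid (atlas_cover p)).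

(* The derivative at p of f with respect to the i-th coordinate of c. *)
Definition partial (M : topologicalType) (c : chart M) (i : 'I_n)
    (f : M -> R) (p : M) : R :=
  'D_(delta_mx 0 i) (f \o chart_inv c) (chart_map c p).

(* metric_mx c p is the matrix (g_ij) of the metric at p, in the coordinates
   of c; it is only meaningful for c in the atlas and p in chart_dom c. *)
Record riemannian_metric (M : manifold) := RiemannianMetric {
  metric_mx :> chart M -> M -> 'M[R]_n;
  metric_smooth : forall c i j, atlas c ->
    smooth_in (chart_img c) (fun x => metric_mx c (chart_inv c x) i j);
  metric_sym : forall c p, atlas c -> chart_dom c p ->
    (metric_mx c p)^T = metric_mx c p;
  metric_posdef : forall c p, atlas c -> chart_dom c p ->
    forall v : 'rV[R]_n, v != 0 -> 0 < (v *m metric_mx c p *m v^T) 0 0;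
  metric_change : forall c c' p, atlas c -> atlas c' ->
    chart_dom c p -> chart_dom c' p ->
    forall i j, metric_mx c p i j =
      \sum_k \sum_l partial c i (fun q => chart_map c' q 0 k) p *
                    partial c j (fun q => chart_map c' q 0 l) p *
                    metric_mx c' p k l }.

Section LeviCivita.
Variables (M : manifold) (g : riemannian_metric M).

(* Gamma^k_ij, where nabla_{d_i} d_j = Gamma^k_ij d_k. *)
Definition christoffel (c : chart M) (k i j : 'I_n) (p : M) : R :=
  2^-1 * \sum_l invmx (g c p) k l *
    (partial c i (fun q => g c q j l) p + partial c j (fun q => g c q i l) p
     - partial c l (fun q => g c q i j) p).

(* The l-th component of R(d_i, d_j) d_k, where
   R(X, Y) Z = nabla_X nabla_Y Z - nabla_Y nabla_X Z - nabla_[X, Y] Z. *)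
Definition riemann (c : chart M) (l i j k : 'I_n) (p : M) : R :=
  partial c i (christoffel c l j k) p - partial c j (christoffel c l i k) p
  + \sum_m (christoffel c m j k p * christoffel c l i m p
            - christoffel c m i k p * christoffel c l j m p).

(* Ric(Y, Z) is the trace of X |-> R(X, Y) Z. *)
Definition ricci (c : chart M) (p : M) : 'M[R]_n :=
  \matrix_(j, k) \sum_i riemann c i i j k p.

(* a g <= Ric <= b g, as bilinear forms. *)
Definition ricci_between (a b : R) : Prop :=
  forall c p, atlas c -> chart_dom c p -> forall v : 'rV[R]_n,
    a * (v *m g c p *m v^T) 0 0 <= (v *m ricci c p *m v^T) 0 0
      <= b * (v *m g c p *m v^T) 0 0.

Definition gradient (c : chart M) (f : M -> R) (i : 'I_n) (p : M) : R :=
  \sum_j invmx (g c p) i j * partial c j f p.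

(* The trace of nabla X, for the vector field X = X^i d_i. *)
Definition divergence (c : chart M) (X : 'I_n -> M -> R) (p : M) : R :=
  \sum_i (partial c i (X i) p + \sum_j christoffel c i i j p * X j p).

(* div (grad f); for smooth f the value at p is the same in all the charts of
   the atlas around p. *)
Definition laplacian (f : M -> R) (p : M) : R :=
  divergence (chart_at p) (gradient (chart_at p) f) p.

End LeviCivita.

(* (t, p) |-> u t p is C^oo on [0, +oo[ x M, up to t = 0; the values of u at
   negative times are irrelevant. *)
Definition smooth_spacetime (M : manifold) (u : R -> M -> R) : Prop :=
  forall c, atlas c ->
    smooth_upto ([set z : 'rV[R]_n * R | chart_img c z.1 /\ 0 <= z.2])
                (fun z => u z.2 (chart_inv c z.1)).

(* The derivative at t of a function on [0, +oo[ is l (right derivative if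
   t = 0). *)
Definition is_time_derive (f : R -> R) (t l : R) : Prop :=
  (s - t)^-1 * (f s - f t) @[s --> within [set s | 0 <= s] t^'] --> l.

Definition heat_solution (M : manifold) (g : riemannian_metric M)
    (u : R -> M -> R) : Prop :=
  forall t p, 0 <= t -> is_time_derive (u ^~ p) t (laplacian g (u t) p).

End Manifolds.

(* 5 K / (1 - e^(-2 K t)), extended by its limit at K = 0. *)
Definition ricci_coef (R : realType) (K t : R) : R :=
  if K == 0 then 5 / (2 * t) else 5 * K / (1 - expR (- 2 * K * t)).

(* Main.v *)
(** For [f = ln u] the heat equation reads [f_t = Lap f + |grad f|^2]. Put
    [W = |grad f|^2], [X = grad f], [B = nabla X] (the Hessian of [f]) and
    [P h = h_t - Lap h - 2 <grad f, grad h>]. Then [P f = - W], [P f_t = 0] and, by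
    the Bochner formula, [P W = - 2 tr (B^2) - 2 Ric(X, X)]. Hence, with
    [c = 5/2 + 2 K0 t], the quantity
      [H = t (f_t + W) - n - c (ln A - f)]
    satisfies [P H <= Lap f + (2 + 2 K0 t - c) W - 2 t tr (B^2)] as long as [f <= ln A],
    and, because [tr (B^2) >= (Lap f)^2 / n] and [t (Lap f + 2 W) >= n] where [H >= 0],
    the right-hand side is nonpositive wherever [H > 0]. The maximum principle gives
    [H <= 0], which implies the claim since [c <= t * ricci_coef K0 t].

    Bochner's formula comes from [grad |X|^2 = 2 nabla_X X] (the Hessian is
    symmetric) and [div (nabla_X X) = X (div X) + Ric(X, X) + tr (B^2)], which
    holds for every vector field [X]. *)

Require Import Defs.
From HB Require Import structures.
From mathcomp Require Import all_boot all_order all_algebra.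
From mathcomp Require Import all_classical all_reals all_analysis.
From mathcomp Require Import ring lra.

Set Implicit Arguments.
Unset Strict Implicit.
Unset Printing Implicit Defensive.

Import Order.TTheory GRing.Theory Num.Theory.
Import numFieldNormedType.Exports.

Local Open Scope classical_set_scope.
Local Open Scope ring_scope.

(** * Smooth functions *)

(** Origin of [c]. In [P H] the part [2 K0 t] of [c] cancels the multiple of [W] that bounds the
    Ricci term of [t P W], while the term [2 K0 (f - ln A)] from its time derivative has the good
    sign. The part [2] cancels the [2 W] produced by differentiating the factor [t]. A surplus [d]
    in [c] leaves [L - d W - 2 t tr (B^2)] with [L = Lap f], whose sign reduces to
    [(L + 2 W) (L - d W) <= 2 L^2]; for [L, W >= 0] this holds as soon as [d >= 6 - 4 sqrt 2]. The
    choice [d = 1/2] makes [c] equal to [t * ricci_coef 0 t = 5/2] when [K0 = 0].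

    Two features of the setting shape the proof. The value of [laplacian] at a point is computed in
    a chart chosen for that point, so [H] can be differentiated only after chart independence has
    identified it with an expression in one fixed chart. And [u] is smooth up to time 0 from one
    side only, so [H] is studied from a time [s > 0] on, with [t - s] in place of [t], and [s] is
    taken small at the end. *)

Section SmoothCalculus.
Variables (R : realType) (V : normedModType R).
Implicit Types (U : set V) (f g : V -> R) (x v w : V).

(* The recursive form of smoothness lets the closure properties be proved by
   induction on the order of differentiation. *)
Fixpoint Ck (k : nat) U f : Prop :=
  if k is k'.+1 then
    [/\ forall x, U x -> {for x, continuous f},
        forall x v, U x -> derivable f x v &
        forall v, Ck k' U ('D_v f)]
  else forall x, U x -> {for x, continuous f}.

Lemma CkW k U f : Ck k.+1 U f -> Ck k U f.
Proof.
elim: k f => [|k IH] f; first by case.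
by move=> [h1 h2 h3]; split => // v; exact: IH.
Qed.

Lemma iter_derive_rcons s v f :
  iter_derive (rcons s v) f = iter_derive s ('D_v f).
Proof. by rewrite /iter_derive foldr_rcons. Qed.

Lemma smooth_in_derive U f v : smooth_in U f -> smooth_in U ('D_v f).
Proof. by move=> sf s x Ux; have := sf (rcons s v) x Ux; rewrite iter_derive_rcons. Qed.

Lemma smooth_in_continuous U f x : smooth_in U f -> U x -> {for x, continuous f}.
Proof. by move=> sf /(sf [::])[]. Qed.

Lemma smooth_in_derivable U f x v : smooth_in U f -> U x -> derivable f x v.
Proof. by move=> sf /(sf [::])[_]; exact. Qed.

Lemma smooth_inP U f : smooth_in U f <-> forall k, Ck k U f.
Proof.
split=> [sf k|Cf s].
  elim: k f sf => [|k IH] f sf /=; first by move=> x; exact: smooth_in_continuous.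
  split => [x|x v|v]; [exact: smooth_in_continuous|exact: smooth_in_derivable|].
  exact/IH/smooth_in_derive.
(* [iter_derive] applies the last direction of the list first, as [Ck] does with its [v], so the
   list is taken apart from its end. *)
elim/last_ind: s f Cf => [|s v IH] f Cf x Ux.
  by have [h1 h2 _] := Cf 1; split; [exact: h1|move=> v; exact: h2].
rewrite iter_derive_rcons; apply: IH Ux => k.
by have [_ _] := Cf k.+1; apply.
Qed.

Lemma smooth_in_sub U U' f : U' `<=` U -> smooth_in U f -> smooth_in U' f.
Proof. by move=> sub sf s x /sub; exact: sf. Qed.

Section OpenDomain.
Variable U : set V.
Hypothesis Uo : open U.

Lemma near_eq_on_open f g x : (forall y, U y -> f y = g y) -> U x -> \near x, f x = g x.
Proof.
by move=> fg Ux; near=> y; apply: fg; near: y; exact: open_nbhs_nbhs.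
Unshelve. all: by end_near. Qed.

Lemma eq_on_derive f g x v : (forall y, U y -> f y = g y) -> U x -> 'D_v f x = 'D_v g x.
Proof. by move=> fg Ux; apply: near_eq_derive; exact: near_eq_on_open. Qed.

Lemma eq_on_continuous f g x : (forall y, U y -> f y = g y) -> U x ->
  {for x, continuous f} -> {for x, continuous g}.
Proof.
move=> fg Ux cf; rewrite /prop_for /continuous_at -(fg _ Ux).
apply: cvg_trans cf; apply: near_eq_cvg.
exact: near_eq_on_open.
Qed.

(** On an open set derivatives depend only on the values taken there. This lets the product,
    quotient and logarithm rules, valid on [U] only, be used like equalities of functions. *)
Lemma eq_on_Ck k f g : (forall y, U y -> f y = g y) -> Ck k U f -> Ck k U g.
Proof.
elim: k f g => [|k IH] f g fg /=.
  by move=> h x Ux; apply: eq_on_continuous fg Ux (h _ Ux).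
move=> [h1 h2 h3]; split => [x Ux|x v Ux|v].
- exact: eq_on_continuous fg Ux (h1 _ Ux).
- exact: near_eq_derivable (near_eq_on_open fg Ux) (h2 _ _ Ux).
- by apply: IH (h3 v) => y Uy; exact: eq_on_derive.
Qed.

Lemma eq_on_smooth f g : (forall y, U y -> f y = g y) -> smooth_in U f -> smooth_in U g.
Proof. by move=> fg /smooth_inP h; apply/smooth_inP => k; exact: eq_on_Ck (h k). Qed.

Lemma Ck_cst k (a : R) : Ck k U (fun=> a).
Proof.
elim: k a => [|k IH] a /=; first by move=> x _; exact: cst_continuous.
split => [x _|x v _|v]; [exact: cst_continuous|exact: derivable_cst|].
by apply: eq_on_Ck (IH 0) => y _; rewrite derive_cst.
Qed.

Lemma CkD k f g : Ck k U f -> Ck k U g -> Ck k U (fun x => f x + g x).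
Proof.
elim: k f g => [|k IH] f g /=.
  by move=> h1 h2 x Ux; apply: continuousD; [exact: h1|exact: h2].
move=> [f1 f2 f3] [g1 g2 g3]; split => [x Ux|x v Ux|v].
- by apply: continuousD; [exact: f1|exact: g1].
- by apply: derivableD; [exact: f2|exact: g2].
- apply: eq_on_Ck (IH _ _ (f3 v) (g3 v)) => y Uy /=.
  by rewrite -(deriveD (f2 _ _ Uy) (g2 _ _ Uy)).
Qed.

Lemma CkM k f g : Ck k U f -> Ck k U g -> Ck k U (fun x => f x * g x).
Proof.
elim: k f g => [|k IH] f g.
  by move=> h1 h2 x Ux; apply: continuousM; [exact: h1|exact: h2].
move=> Cf Cg; move: (Cf) (Cg) => [f1 f2 f3] [g1 g2 g3]; split => [x Ux|x v Ux|v].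
- by apply: continuousM; [exact: f1|exact: g1].
- by apply: derivableM; [exact: f2|exact: g2].
- apply: eq_on_Ck (CkD (IH _ _ (CkW Cf) (g3 v)) (IH _ _ (CkW Cg) (f3 v))) => y Uy /=.
  by rewrite -[LHS](deriveM (f2 _ _ Uy) (g2 _ _ Uy)).
Qed.

(** The derivative of [1 / f] is [- (1 / f)^2 f']: it involves [1 / f] itself at the lower order,
    whence an induction on [k] with [f] fixed. *)
Lemma CkV k f : (forall x, U x -> f x != 0) -> Ck k U f -> Ck k U (fun x => (f x)^-1).
Proof.
move=> f0; elim: k => [|k IH].
  by move=> h x Ux; apply: continuousV; [exact: f0|exact: h].
move=> Cf; move: (Cf) => [f1 f2 f3]; split => [x Ux|x v Ux|v].
- by apply: continuousV; [exact: f0|exact: f1].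
- by apply: derivableV; [exact: f0|exact: f2].
- have Ci := IH (CkW Cf).
  apply: eq_on_Ck (CkM (CkM (Ck_cst k (-1)) (CkM Ci Ci)) (f3 v)) => y Uy /=.
  rewrite [RHS]deriveV; [|exact: f0|exact: f2].
  by rewrite mulN1r -invfM -expr2.
Qed.

Lemma derive_ln f x v : 0 < f x -> derivable f x v ->
  is_derive x v (fun y => ln (f y)) ('D_v f x / f x).
Proof.
move=> f0 df.
have [dl lnd] := is_derive1_ln f0.
(* On the line through [x] in direction [v], this is the one-variable chain rule at parameter 0. *)
pose F (s : R) := f (s *: v + x).
have F0 : F 0 = f x by rewrite /F scale0r add0r.
have df1 : derivable F 0 1 := (derivable1P f x v).1 df.
have dl' : derivable (@ln R) (F 0) 1 := eq_ind_r (fun y => derivable (@ln R) y 1) dl F0.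
have dc : derivable (@ln R \o F) 0 1.
  apply/derivable1_diffP.
  by apply: differentiable_comp; apply/derivable1_diffP; [exact: df1|exact: dl'].
apply: DeriveDef; first exact: (derivable1P (fun y => ln (f y)) x v).2.
have cnv (h : V -> R) : 'D_v h x = (fun s : R => h (s *: v + x))^`()%classic 0.
  rewrite derive1E /derive; set g1 := fun s => s^-1 *: _; set g2 := fun s => s^-1 *: _.
  suff -> : g1 = g2 by [].
  by rewrite funeqE /g1 /g2 => s /=; rewrite addr0 scale0r add0r [_%:A]mulr1.
rewrite !cnv; have -> := derive1_comp df1 dl'.
by rewrite F0 derive1E lnd mulrC.
Qed.

Lemma Ck_ln k f : (forall x, U x -> 0 < f x) -> Ck k U f -> Ck k U (fun x => ln (f x)).
Proof.
move=> f0; elim: k => [|k IH].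
  move=> h x Ux; apply: (@continuous_comp _ _ _ f (@ln R)); first exact: h.
  exact/continuous_ln/f0.
move=> Cf; move: (Cf) => [f1 f2 f3]; split => [x Ux|x v Ux|v].
- apply: (@continuous_comp _ _ _ f (@ln R)); first exact: f1.
  exact/continuous_ln/f0.
- by have [] := derive_ln (f0 _ Ux) (f2 x v Ux).
- have Ci : Ck k U (fun x => (f x)^-1).
    by apply: CkV (CkW Cf) => x /f0; rewrite lt0r => /andP[].
  apply: eq_on_Ck (CkM (f3 v) Ci) => y Uy /=.
  by have [_ ->] := derive_ln (f0 _ Uy) (f2 y v Uy).
Qed.

Lemma smooth_cst (a : R) : smooth_in U (fun=> a).
Proof. by apply/smooth_inP => k; exact: Ck_cst. Qed.

Lemma smoothD f g : smooth_in U f -> smooth_in U g -> smooth_in U (fun x => f x + g x).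
Proof. by move=> /smooth_inP hf /smooth_inP hg; apply/smooth_inP => k; exact: CkD. Qed.

Lemma smoothM f g : smooth_in U f -> smooth_in U g -> smooth_in U (fun x => f x * g x).
Proof. by move=> /smooth_inP hf /smooth_inP hg; apply/smooth_inP => k; exact: CkM. Qed.

Lemma smoothN f : smooth_in U f -> smooth_in U (fun x => - f x).
Proof.
move=> /(smoothM (smooth_cst (-1))); apply: eq_on_smooth => y _.
by rewrite mulN1r.
Qed.

Lemma smoothB f g : smooth_in U f -> smooth_in U g -> smooth_in U (fun x => f x - g x).
Proof. by move=> hf hg; exact: smoothD hf (smoothN hg). Qed.

Lemma smoothV f : (forall x, U x -> f x != 0) -> smooth_in U f ->
  smooth_in U (fun x => (f x)^-1).
Proof. by move=> f0 /smooth_inP hf; apply/smooth_inP => k; exact: CkV. Qed.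

Lemma smooth_ln f : (forall x, U x -> 0 < f x) -> smooth_in U f ->
  smooth_in U (fun x => ln (f x)).
Proof. by move=> f0 /smooth_inP hf; apply/smooth_inP => k; exact: Ck_ln. Qed.

Lemma Ck_sum k (I : Type) (r : seq I) (P : pred I) (F : I -> V -> R) :
  (forall i, Ck k U (F i)) -> Ck k U (fun x => \sum_(i <- r | P i) F i x).
Proof.
move=> sF; elim: r => [|i r IH].
  by apply: eq_on_Ck (Ck_cst k 0) => y _; rewrite big_nil.
have [Pi|Pi] := boolP (P i).
  by apply: eq_on_Ck (CkD (sF i) IH) => y _; rewrite big_cons Pi.
by apply: eq_on_Ck IH => y _; rewrite big_cons (negbTE Pi).
Qed.

Lemma smooth_sum (I : Type) (r : seq I) (P : pred I) (F : I -> V -> R) :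
  (forall i, smooth_in U (F i)) -> smooth_in U (fun x => \sum_(i <- r | P i) F i x).
Proof.
move=> sF; apply/smooth_inP => k; apply: Ck_sum => i.
exact: (smooth_inP _ _).1 (sF i) k.
Qed.

Lemma smooth_prod (I : Type) (r : seq I) (P : pred I) (F : I -> V -> R) :
  (forall i, smooth_in U (F i)) -> smooth_in U (fun x => \prod_(i <- r | P i) F i x).
Proof.
move=> sF; elim: r => [|i r IH].
  by apply: eq_on_smooth (smooth_cst 1) => y _; rewrite big_nil.
have [Pi|Pi] := boolP (P i).
  by apply: eq_on_smooth (smoothM (sF i) IH) => y _; rewrite big_cons Pi.
by apply: eq_on_smooth IH => y _; rewrite big_cons (negbTE Pi).
Qed.

Lemma smooth_det n (A : V -> 'M[R]_n) : (forall i j, smooth_in U (fun x => A x i j)) ->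
  smooth_in U (fun x => \det (A x)).
Proof.
move=> sA; rewrite /determinant; apply: smooth_sum => s.
by apply: smoothM; [exact: smooth_cst|exact: smooth_prod].
Qed.

(** By Cramer's formula the entries of the inverse are cofactors divided by the determinant. *)
Lemma smooth_invmx n (A : V -> 'M[R]_n) : (forall i j, smooth_in U (fun x => A x i j)) ->
  (forall x, U x -> A x \in unitmx) ->
  forall i j, smooth_in U (fun x => invmx (A x) i j).
Proof.
move=> sA uA i j.
have sC : smooth_in U (fun x => cofactor (A x) j i).
  apply: smoothM; first exact: smooth_cst.
  apply: smooth_det => k l; apply: eq_on_smooth (sA (lift j k) (lift i l)) => y _.
  by rewrite !mxE.
have sd : smooth_in U (fun x => (\det (A x))^-1).
  by apply: smoothV; [move=> x /uA; rewrite unitmxE unitfE|exact: smooth_det].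
apply: eq_on_smooth (smoothM sd sC) => y Uy.
by rewrite /invmx (uA _ Uy) !mxE.
Qed.

Lemma derive_add_in f g x v : smooth_in U f -> smooth_in U g -> U x ->
  'D_v (fun y => f y + g y) x = 'D_v f x + 'D_v g x.
Proof.
move=> sf sg Ux; rewrite -(deriveD (smooth_in_derivable sf Ux) (smooth_in_derivable sg Ux)).
by [].
Qed.

Lemma derive_mul_in f g x v : smooth_in U f -> smooth_in U g -> U x ->
  'D_v (fun y => f y * g y) x = f x * 'D_v g x + g x * 'D_v f x.
Proof.
move=> sf sg Ux; have := deriveM (smooth_in_derivable sf Ux) (smooth_in_derivable sg Ux).
by move=> ->.
Qed.

Lemma derive_scale_in (a : R) f x v : smooth_in U f -> U x ->
  'D_v (fun y => a * f y) x = a * 'D_v f x.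
Proof.
move=> sf Ux; rewrite (derive_mul_in v (smooth_cst a) sf Ux).
by rewrite derive_cst mulr0 addr0.
Qed.

Lemma derive_sum_in (I : finType) (F : I -> V -> R) x v :
  (forall i, smooth_in U (F i)) -> U x ->
  'D_v (fun y => \sum_i F i y) x = \sum_i 'D_v (F i) x.
Proof.
move=> sF Ux; elim: (index_enum I) => [|i r IH].
  rewrite big_nil (_ : (fun _ => _) = fun=> 0) ?derive_cst //.
  by apply/funext => y; rewrite big_nil.
rewrite big_cons -IH (_ : (fun _ => _) = fun y => F i y + \sum_(j <- r) F j y).
  exact: derive_add_in v (sF i) (smooth_sum _ _ sF) Ux.
by apply/funext => y; rewrite big_cons.
Qed.

End OpenDomain.
End SmoothCalculus.
Arguments smooth_in_derivable {R V U f x} v _ _.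
Arguments smooth_in_derive {R V U f} v _.

(** * Mean values along lines; symmetry and sign of second derivatives *)

Section Lines.
Variables (R : realType) (V : normedModType R).
Implicit Types (f : V -> R) (x v w : V).

Lemma is_derive_line f x v (s : R) : derivable f (s *: v + x) v ->
  is_derive s 1 (fun s => f (s *: v + x)) ('D_v f (s *: v + x)).
Proof.
have E : (fun h : R => h^-1 *: (((fun s => f (s *: v + x)) \o shift s) (h *: (1 : R))
             - f (s *: v + x))) =
         (fun h => h^-1 *: ((f \o shift (s *: v + x)) (h *: v) - f (s *: v + x))).
  by apply/funext => h /=; rewrite [_ *: 1]mulr1 scalerDl addrA.
move=> df; apply: DeriveDef; first by rewrite /derivable E; exact: df.
by rewrite /derive E.
Qed.

Lemma MVT_line f x v (a : R) :
  (forall s, `|s| <= `|a| -> derivable f (s *: v + x) v) ->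
  exists2 c, `|c| <= `|a| & f (a *: v + x) - f x = a * 'D_v f (c *: v + x).
Proof.
move=> df; pose F s := f (s *: v + x); pose dF s := 'D_v f (s *: v + x).
have F0 : F 0 = f x by rewrite /F scale0r add0r.
have dFs (s : R) : `|s| <= `|a| -> is_derive s (1 : R) F (dF s).
  by move=> sa; exact: is_derive_line (df _ sa).
rewrite -F0 -[f (a *: v + x)]/(F a).
have [a0|a0] := leP 0 a.
  have sa s : s \in `[0, a] -> `|s| <= `|a|.
    by rewrite in_itv /= => /andP[s0 sa]; rewrite !ger0_norm.
  have [| |c /sa ca ->] := @MVT_segment R F dF 0 a a0.
  - by move=> s sI; apply/dFs/sa; apply: subset_itv_oo_cc sI.
  - apply: derivable_within_continuous => s /sa sI.
    by have [] := dFs _ sI.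
  - by exists c => //; rewrite subr0 mulrC.
have sa s : s \in `[a, 0] -> `|s| <= `|a|.
  by rewrite in_itv /= => /andP[s0 sa]; rewrite (ltr0_norm a0) ler0_norm // lerN2.
have [| |c /sa ca e] := @MVT_segment R F dF a 0 (ltW a0).
- by move=> s sI; apply/dFs/sa; apply: subset_itv_oo_cc sI.
- apply: derivable_within_continuous => s /sa sI.
  by have [] := dFs _ sI.
- by exists c => //; rewrite -opprB e sub0r mulrN opprK mulrC.
Qed.

Lemma near_parallelogram x v w (P : set V) : (\forall y \near x, P y) ->
  exists2 r : R, 0 < r & forall s t : R, `|s| <= r -> `|t| <= r ->
    P (s *: v + (t *: w + x)).
Proof.
move=> /nbhs_ballP[e e0 eP].
(* The summand 1 keeps the denominator positive when both [v] and [w] vanish. *)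
have d0 : 0 < 1 + `|v| + `|w| by rewrite -addrA ltr_pwDl // addr_ge0.
have q0 : 0 < e / 2 / (1 + `|v| + `|w|) by rewrite !divr_gt0.
exists (e / 2 / (1 + `|v| + `|w|)) => //.
move=> s t sr tr; apply: eP; rewrite -ball_normE /ball_ /=.
rewrite addrA opprD addrCA subrr addr0 normrN.
apply: (@le_lt_trans _ _ (e / 2)); last by rewrite ltr_pdivrMr// ltr_pMr// ltr1n.
have -> : e / 2 = e / 2 / (1 + `|v| + `|w|) * (1 + `|v| + `|w|).
  by rewrite divfK // gt_eqF.
apply: le_trans (ler_normD _ _) _; rewrite !normrZ.
apply: (@le_trans _ _ (e / 2 / (1 + `|v| + `|w|) * `|v| +
                       e / 2 / (1 + `|v| + `|w|) * `|w|)).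
  by rewrite lerD // ler_wpM2r.
rewrite -mulrDr ler_wpM2l ?(ltW q0) //; by rewrite -addrA lerDr.
Qed.

(** The mean value theorem is applied in direction [v] to the increment of [f] along [r w], then in
    direction [w] to ['D_v f]. Since the second difference is symmetric in [v] and [w], it computes
    both mixed derivatives. *)
Lemma second_difference f (U : set V) x v w r : 0 < r -> smooth_in U f ->
  (forall s t : R, `|s| <= r -> `|t| <= r -> U (s *: v + (t *: w + x))) ->
  exists s t : R, [/\ `|s| <= r, `|t| <= r &
   f (r *: v + (r *: w + x)) - f (r *: w + x) - (f (r *: v + x) - f x) =
   r * (r * 'D_w ('D_v f) (s *: v + (t *: w + x)))].
Proof.
move=> r0 sf Ur.
have rr : `|r| = r by rewrite gtr0_norm.
have Uv s : `|s| <= r -> U (s *: v + x).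
  by move=> sr; have := Ur s 0 sr; rewrite normr0 scale0r add0r; apply; exact: ltW.
pose F s := f (s *: v + (r *: w + x)) - f (s *: v + x).
pose F' s := 'D_v f (s *: v + (r *: w + x)) - 'D_v f (s *: v + x).
have dF (s : R) : `|s| <= r -> is_derive s (1 : R) F (F' s).
  move=> sr; have U1 : U (s *: v + (r *: w + x)) by apply: Ur => //; rewrite rr.
  have a1 := is_derive_line (smooth_in_derivable v sf U1).
  have a2 := is_derive_line (smooth_in_derivable v sf (Uv _ sr)).
  exact: (is_deriveB a1 a2).
have sa s : s \in `[0, r] -> `|s| <= r.
  by rewrite in_itv /= => /andP[s0 sr]; rewrite ger0_norm.
have [| |c /sa ca e] := @MVT_segment R F F' 0 r (ltW r0).
- move=> s sI; apply/dF/sa; exact: subset_itv_oo_cc sI.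
- apply: derivable_within_continuous => s /sa sI.
  by have [] := dF _ sI.
have [|t tr e'] := @MVT_line ('D_v f) (c *: v + x) w r.
  move=> s; rewrite rr => sr; apply: (smooth_in_derivable _ (smooth_in_derive _ sf)).
  by rewrite addrCA; exact: Ur.
exists c, t; split => //; first by rewrite -rr.
move: e; rewrite /F /F' scale0r !add0r subr0 => e.
have -> : f (r *: v + (r *: w + x)) - f (r *: w + x) - (f (r *: v + x) - f x)
  = f (r *: v + (r *: w + x)) - f (r *: v + x) - (f (r *: w + x) - f x) by ring.
by rewrite e mulrC [X in _ * ('D_v f X - _)]addrCA e' [t *: w + _]addrCA.
Qed.

Lemma continuous_near_dist (T : topologicalType) (h : T -> R) y (e : R) :
  {for y, continuous h} -> 0 < e -> \forall z \near y, `|h y - h z| < e.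
Proof. by move=> /cvgrPdist_lt; apply. Qed.

(** The mean value points for the two orders of differentiation differ, so the mixed derivatives can
    only be compared at distinct points close to [x]; continuity then gives equality at [x]. *)
Lemma continuous_near_eq (a b : V -> R) x :
  {for x, continuous a} -> {for x, continuous b} ->
  (forall P : set V, (\forall y \near x, P y) -> exists y z, [/\ P y, P z & a y = b z]) ->
  a x = b x.
Proof.
move=> ca cb H; apply/eqP; rewrite -subr_eq0 -normr_le0; apply/ler_addgt0Pr => e e0.
rewrite add0r; have e20 : 0 < e / 2 by rewrite divr_gt0.
have [y [z [[ay _] [_ bz] ab]]] :=
  H _ (filterI (continuous_near_dist ca e20) (continuous_near_dist cb e20)).
rewrite (splitr e); apply: le_trans (lerD (ltW ay) (ltW bz)).
rewrite [`|b x - _|]distrC -ab; apply: le_trans (ler_normD _ _).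
by rewrite addrA subrK.
Qed.

Lemma derive_comm f (U : set V) x v w : open U -> smooth_in U f -> U x ->
  'D_w ('D_v f) x = 'D_v ('D_w f) x.
Proof.
move=> Uo sf Ux; apply: (@continuous_near_eq ('D_w ('D_v f)) ('D_v ('D_w f)) x).
- exact: smooth_in_continuous (smooth_in_derive w (smooth_in_derive v sf)) Ux.
- exact: smooth_in_continuous (smooth_in_derive v (smooth_in_derive w sf)) Ux.
move=> P nP.
have nU : \forall y \near x, U y by exact: open_nbhs_nbhs.
have [r r0 rP] := near_parallelogram v w (filterI nP nU).
have [|s [t [sr tr e1]]] := @second_difference f U x v w r r0 sf.
  by move=> s t sr tr; case: (rP s t sr tr).
have [|s' [t' [sr' tr' e2]]] := @second_difference f U x w v r r0 sf.
  by move=> s' t' sr' tr'; rewrite addrCA; case: (rP t' s' tr' sr').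
have [Py _] := rP _ _ sr tr; have [Pz _] := rP _ _ tr' sr'.
exists (s *: v + (t *: w + x)), (t' *: v + (s' *: w + x)).
split; [exact: Py|exact: Pz|].
move: e2; rewrite [s' *: w + _]addrCA [r *: w + (r *: v + x)]addrCA.
move: e1; move: ('D_w _ _) ('D_v _ _) => a b e1 e2.
apply: (mulfI (lt0r_neq0 r0)); apply: (mulfI (lt0r_neq0 r0)); rewrite -e1 -e2.
ring.
Qed.

Lemma second_derive_le0 f (U : set V) x v : open U -> smooth_in U f -> U x ->
  (\forall y \near x, f y <= f x) -> 'D_v f x = 0 /\ 'D_v ('D_v f) x <= 0.
Proof.
move=> Uo sf Ux fx.
have nU : \forall y \near x, U y by exact: open_nbhs_nbhs.
have [r r0 rP] := near_parallelogram v 0 (filterI fx nU).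
have {}rP (s : R) : `|s| <= r -> f (s *: v + x) <= f x /\ U (s *: v + x).
  by move=> sr; have := rP s 0 sr; rewrite scaler0 add0r normr0; apply; exact: ltW.
pose F s := f (s *: v + x).
have F0 : F 0 = f x by rewrite /F scale0r add0r.
have dF (s : R) : `|s| <= r -> is_derive s (1 : R) F ('D_v f (s *: v + x)).
  by move=> /rP[_ Us]; exact: is_derive_line (smooth_in_derivable v sf Us).
have rr (s : R) : s \in `](- r), r[ -> `|s| <= r.
  by rewrite in_itv /= -ltr_norml => /ltW.
have D0 : 'D_v f x = 0.
  have r00 : - r <= r by rewrite (@le_trans _ _ 0) ?oppr_le0 ?ltW.
  have m0 : (0 : R) \in `](- r), r[ by rewrite in_itv /= oppr_lt0 r0.
  have dFr (t : R) : t \in `](- r), r[ -> derivable F t 1 by move=> /rr tr; have [] := dF t tr.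
  have Fmax (t : R) : t \in `](- r), r[ -> F t <= F 0.
    by move=> /rr tr; rewrite F0; have [] := rP t tr.
  have [_ e1] := derive1_at_max r00 dFr m0 Fmax.
  have [|_ e2] := dF 0; first by rewrite normr0 ltW.
  by rewrite -e1 e2 scale0r add0r.
split; first exact: D0.
(* If the second derivative were positive at [x], it would be so nearby; the first derivative, zero
   at [x], would be positive just after, and [f] would increase along [v]. *)
rewrite leNgt; apply/negP => D2.
have c2 := smooth_in_continuous (smooth_in_derive v (smooth_in_derive v sf)) Ux.
have [r2 r20 r2P] := near_parallelogram v 0 (continuous_near_dist c2 D2).
have {}r2P (s : R) : `|s| <= r2 -> 0 < 'D_v ('D_v f) (s *: v + x).
  move=> sr; have := r2P s 0 sr; rewrite scaler0 add0r normr0 => /(_ (ltW r20)).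
  by move: ('D_v _ _) ('D_v _ _) => a b; rewrite ltr_norml => /andP[]; lra.
pose q := Num.min r r2.
have q0 : 0 < q by rewrite lt_min r0.
have qr (s : R) : `|s| <= q -> `|s| <= r /\ `|s| <= r2.
  by rewrite le_min => /andP[].
have qI (s : R) : s \in `[0, q] -> `|s| <= r.
  by rewrite in_itv /= => /andP[s0 sq]; have [|//] := qr s; rewrite ger0_norm.
have F'pos (s : R) : s \in `]0, q[ -> 0 < F^`()%classic s.
  rewrite in_itv /= => /andP[s0 sq].
  have [sr sr2] : `|s| <= r /\ `|s| <= r2 by apply: qr; rewrite gtr0_norm // ltW.
  rewrite derive1E; have [_ ->] := dF s sr.
  have [|c cs] := @MVT_line ('D_v f) x v s.
    move=> t ts; have [|_ Ut] := rP t; first exact: le_trans ts sr.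
    exact: smooth_in_derivable v (smooth_in_derive v sf) Ut.
  rewrite D0 subr0 => ->; apply: mulr_gt0; first exact: s0.
  by apply: r2P; exact: le_trans cs sr2.
have dFq (s : R) : s \in `]0, q[ -> derivable F s 1.
  by move=> sI; have [] := dF s (qI _ (subset_itv_oo_cc sI)).
have cF : {within `[0, q], continuous F}.
  by apply: derivable_within_continuous => s /qI sI; have [] := dF _ sI.
have := gtr0_derive1_lt_cc dFq F'pos cF.
move=> /(_ 0 q); rewrite !in_itv /= !lexx (ltW q0) => /(_ isT isT q0).
rewrite F0 ltNge => /negP; apply.
have [|qr1 _] := qr q; first by rewrite gtr0_norm.
by have [] := rP q qr1.
Qed.

End Lines.

Lemma differentiable_taylor (R : realType) (V W : normedModType R) (f : V -> W)
    (df : {linear V -> W}) x : continuous df ->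
  (forall e : R, 0 < e -> \forall h \near 0, `|f (h + x) - f x - df h| <= e * `|h|) ->
  differentiable f x /\ 'd f x = df :> (V -> W).
Proof.
move=> cdf H.
have E : f \o shift x = cst (f x) + df +o_ 0 id.
  apply/eqaddoP => e e0; have := H e e0; apply: filterS => h.
  by rewrite /= -[(_ - _) h]/(f (h + x) - (f x + df h)) opprD addrA.
have D := diff_unique cdf E.
by split; [apply/diff_locallyP; split; rewrite D|exact: D].
Qed.

(** * Differentiability from continuous partial derivatives, and the chain rule *)

Section ChainRule.
Variables (R : realType) (n : nat).
Implicit Types (F : 'rV[R]_n -> R) (y : 'rV[R]_n).

Lemma rV_norm_le (x : 'rV[R]_n) (b : R) : 0 <= b -> (forall i, `|x 0 i| <= b) -> `|x| <= b.
Proof.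
move=> b0 xb; rewrite /Num.Def.normr/= mx_normrE; apply: bigmax_le => //= -[i j] _ /=.
by rewrite (ord1 i).
Qed.

Lemma rV_coord_le (x : 'rV[R]_n) i : `|x 0 i| <= `|x|.
Proof.
rewrite [leRHS]/Num.Def.normr/= mx_normrE.
exact: (le_bigmax _ (fun ij : 'I_1 * 'I_n => `|x ij.1 ij.2|) (0, i)).
Qed.

Definition lin_form (a : 'I_n -> R) (v : 'rV[R]_n) : R := \sum_k v 0 k * a k.

Fact lin_form_linear a : linear (lin_form a).
Proof.
move=> c u v; transitivity (c * lin_form a u + lin_form a v); last by [].
rewrite /lin_form mulr_sumr -big_split /=.
by apply: eq_bigr => k _; rewrite !mxE mulrDl mulrA.
Qed.

HB.instance Definition _ a := GRing.isLinear.Build R 'rV[R]_n R _ (lin_form a) (lin_form_linear a).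

Lemma lin_form_continuous a : continuous (lin_form a).
Proof.
rewrite /lin_form; apply: continuous_big => [|k _ w]; first exact: add_continuous.
apply: (@continuousM _ _ (fun w : 'rV[R]_n => w 0 k) (fun=> a k)).
  exact: coord_continuous.
exact: cst_continuous.
Qed.

Lemma C1_taylor (U : set 'rV[R]_n) F y : open U -> U y -> smooth_in U F ->
  forall e : R, 0 < e -> \forall h \near (0 : 'rV[R]_n),
    `|F (h + y) - F y - lin_form (fun k => 'D_(delta_mx 0 k) F y) h| <= e * `|h|.
Proof.
move=> Uo Uy sF e e0.
(* The [n] coordinates contribute one error each; [n.+1] avoids dividing by zero in dimension 0. *)
have e10 : 0 < e / n.+1%:R by rewrite divr_gt0.
have nU : \forall z \near y, U z by exact: open_nbhs_nbhs.
have nDk (k : 'I_n) : \forall z \near y,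
    `|'D_(delta_mx 0 k) F y - 'D_(delta_mx 0 k) F z| < e / n.+1%:R.
  have cD := smooth_in_continuous (smooth_in_derive (delta_mx 0 k) sF) Uy.
  exact: continuous_near_dist cD e10.
have nD := filter_forall (nbhs_filter y) nDk.
have nUD : \forall z \near y, U z /\ forall k : 'I_n,
    `|'D_(delta_mx 0 k) F y - 'D_(delta_mx 0 k) F z| < e / n.+1%:R by exact: filterI.
have [d d0 dP] := (nbhs_ballP y _).1 nUD.
apply/nbhs_ballP; exists d => // h; rewrite -ball_normE /ball_ /= sub0r normrN => hd.
(* The points [Z k + y] lead from [y] to [h + y] by changing one coordinate at a time. The norm is
   the supremum norm, so every mean value point on the way stays within distance [|h|] of [y]. *)
pose Z k : 'rV[R]_n := \row_i (if (i < k)%N then h 0 i else 0).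
have ZS (k : 'I_n) : Z k.+1 = h 0 k *: delta_mx 0 k + Z k.
  apply/rowP => i; rewrite !mxE /= ltnS leq_eqVlt.
  have [/val_inj ->|ik] /= := eqVneq (val i) (val k).
    by rewrite eqxx ltnn mulr1 addr0.
  rewrite (_ : (i == k) = false) ?mulr0 ?add0r //.
  by apply/negbTE; apply: contra ik => /eqP ->.
have inU (k : 'I_n) (c : R) : `|c| <= `|h 0 k| -> ball y d (c *: delta_mx 0 k + (Z k + y)).
  move=> ch; rewrite -ball_normE /ball_ /= addrA opprD addrCA subrr addr0 normrN.
  apply: le_lt_trans hd; apply: rV_norm_le => // i; rewrite !mxE /=.
  have [->|ik] := eqVneq i k; first by rewrite ltnn addr0 mulr1 (le_trans ch) // rV_coord_le.
  by rewrite mulr0 add0r; case: ifP => // _; [exact: rV_coord_le|rewrite normr0].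
have Zn : Z n = h by apply/rowP => i; rewrite !mxE ltn_ord.
have step k : (k <= n)%N -> `|F (Z k + y) - F y -
    \sum_(i < n | (i < k)%N) h 0 i * 'D_(delta_mx 0 i) F y| <= k%:R * (e / n.+1%:R * `|h|).
  elim: k => [|k IH] kn.
    rewrite (_ : Z 0 = 0) ?add0r; last by apply/rowP => i; rewrite !mxE.
    by rewrite big_pred0 // subrr subr0 normr0 mul0r.
  pose k' := Ordinal kn.
  have [|c ch ec] := @MVT_line R _ F (Z k + y) (delta_mx 0 k') (h 0 k').
    by move=> s /(inU k')/dP[Us _]; exact: smooth_in_derivable sF Us.
  rewrite (ZS k') -[_ *: _ + _ + y]addrA (bigD1 k') /= ?ltnSn //.
  rewrite (eq_bigl (fun i : 'I_n => (i < k)%N)); last first.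
    by move=> i; rewrite -val_eqE /= ltnS; case: ltngtP.
  have [_ /(_ k') Dk] := dP _ (inU k' c ch).
  move: IH => /(_ (ltnW kn)).
  have -> : F (h 0 k' *: delta_mx 0 k' + (Z k' + y)) =
      F (Z k + y) + h 0 k' * 'D_(delta_mx 0 k') F (c *: delta_mx 0 k' + (Z k + y)).
    by rewrite -ec [RHS]addrC subrK.
  move: Dk; move: ('D_(delta_mx 0 k') F _) ('D_(delta_mx 0 k') F _) => b a ab IH.
  have -> : F (Z k + y) + h 0 k' * b - F y -
      (h 0 k' * a + \sum_(i < n | (i < k)%N) h 0 i * 'D_(delta_mx 0 i) F y) =
      (F (Z k + y) - F y - \sum_(i < n | (i < k)%N) h 0 i * 'D_(delta_mx 0 i) F y)
      + h 0 k' * (b - a) by ring.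
  apply: le_trans (ler_normD _ _) _; rewrite -natr1 mulrDl mul1r; apply: lerD IH _.
  rewrite normrM mulrC; apply: ler_pM => //; first by rewrite distrC ltW.
  exact: rV_coord_le.
have := step n (leqnn n); rewrite Zn (eq_bigl xpredT); last by move=> i; rewrite ltn_ord.
move=> /le_trans; apply.
rewrite mulrA; apply: ler_wpM2r => //.
by rewrite mulrCA ger_pMr // ler_pdivrMr // mul1r ler_nat.
Qed.

Lemma C1_differentiable (U : set 'rV[R]_n) F y : open U -> U y -> smooth_in U F ->
  differentiable F y /\ 'd F y = lin_form (fun k => 'D_(delta_mx 0 k) F y) :> (_ -> _).
Proof.
move=> Uo Uy sF; pose df := lin_form (fun k => 'D_(delta_mx 0 k) F y).
have cdf : continuous df := @lin_form_continuous _.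
exact: differentiable_taylor cdf (C1_taylor Uo Uy sF).
Qed.

End ChainRule.

Section ChainRule2.
Variables (R : realType) (n : nat) (V : normedModType R).

Lemma derivable_chain (U : set 'rV[R]_n) (F : 'rV[R]_n -> R) (phi : V -> 'rV[R]_n) x v :
  open U -> U (phi x) -> smooth_in U F -> (forall k, derivable (fun z => phi z 0 k) x v) ->
  derivable (fun z => F (phi z)) x v.
Proof.
move=> Uo Ux sF dphi.
have [dF _] := C1_differentiable Uo Ux sF.
pose G h := phi (h *: v + x).
have G0 : G 0 = phi x by rewrite /G scale0r add0r.
have dphi' : derivable phi x v by apply/derivable_mxP => i j; rewrite (ord1 i); exact: dphi.
have dG : differentiable G 0.
  by apply/derivable1_diffP; exact: (derivable1P phi x v).1 dphi'.
have dF' : differentiable F (G 0) by rewrite G0.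
apply: (derivable1P (fun z => F (phi z)) x v).2.
by apply/derivable1_diffP; exact: (differentiable_comp dG dF').
Qed.

Lemma derive_chain (U : set 'rV[R]_n) (F : 'rV[R]_n -> R) (phi : V -> 'rV[R]_n) x v :
  open U -> U (phi x) -> smooth_in U F -> (forall k, derivable (fun z => phi z 0 k) x v) ->
  'D_v (fun z => F (phi z)) x =
  \sum_k 'D_v (fun z => phi z 0 k) x * 'D_(delta_mx 0 k) F (phi x).
Proof.
move=> Uo Ux sF dphi.
have [dF eF] := C1_differentiable Uo Ux sF.
pose G h := phi (h *: v + x).
have G0 : G 0 = phi x by rewrite /G scale0r add0r.
have cnv (W : normedModType R) (h : V -> W) : 'D_v h x = 'D_1 (fun s : R => h (s *: v + x)) 0.
  rewrite /derive; set g1 := fun s => s^-1 *: _; set g2 := fun s => s^-1 *: _.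
  suff -> : g1 = g2 by [].
  by rewrite funeqE /g1 /g2 => s /=; rewrite addr0 scale0r add0r [_%:A]mulr1.
have dphi' : derivable phi x v by apply/derivable_mxP => i j; rewrite (ord1 i); exact: dphi.
have dG : differentiable G 0.
  by apply/derivable1_diffP; exact: (derivable1P phi x v).1 dphi'.
have dF' : differentiable F (G 0) by rewrite G0.
rewrite cnv (deriveE _ (differentiable_comp dG dF')) (diff_comp dG dF') /=.
rewrite -(deriveE _ dG) -[X in 'd F _ X]cnv derive_mx // G0 eF.
by apply: eq_bigr => k _; rewrite mxE.
Qed.

End ChainRule2.

(** * Linear algebra *)

Section PositiveDefinite.
Variable R : realType.

Definition posdef n (G : 'M[R]_n) :=
  G^T = G /\ forall v : 'rV[R]_n, v != 0 -> 0 < (v *m G *m v^T) 0 0.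

(* One elimination step: conjugation by Q1 leaves the Schur complement C'. *)
Lemma posdef_orthonormalize n (G : 'M[R]_n) : posdef G ->
  exists Q : 'M[R]_n, Q *m G *m Q^T = 1%:M.
Proof.
elim: n G => [|n IH] G [sG pG]; first by exists 0; apply/matrixP => -[].
rewrite -[n.+1]/(1 + n)%N in G sG pG *.
pose a := G 0 0; pose b : 'rV_n := ursubmx G; pose C := drsubmx G.
have Gul : ulsubmx G = a%:M.
  by apply/matrixP => i j; rewrite !ord1 !mxE eqxx mulr1n; congr (G _ _); apply: val_inj.
have Gdl : dlsubmx G = b^T by rewrite /b trmx_ursub sG.
have EG : G = block_mx a%:M b b^T C by rewrite -[LHS]submxK Gul Gdl.
have sC : C^T = C by rewrite /C trmx_drsub sG.
have a0 : 0 < a.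
  have := pG (delta_mx 0 0); rewrite -rowE => /(_ _)/wrap[].
    by apply/eqP => /matrixP/(_ 0 0)/eqP; rewrite !mxE eqxx oner_eq0.
  by rewrite trmx_delta -colE !mxE.
pose Q1 : 'M[R]_(1 + n) := block_mx 1%:M 0 (- (a^-1 *: b^T)) 1%:M.
pose C' := C - a^-1 *: (b^T *m b).
have E1 : Q1 *m G *m Q1^T = block_mx a%:M 0 0 C'.
  rewrite EG /Q1 tr_block_mx !mulmx_block !trmx1 !trmx0 !mul1mx !mul0mx !addr0.
  rewrite !mulmx1 !mulmx0 !addr0 linearN /= linearZ /= trmxK.
  have e1 : a%:M *m - (a^-1 *: b) + b = 0.
    by rewrite mul_scalar_mx scalerN scalerA mulfV ?gt_eqF // scale1r addNr.
  have e2 : - (a^-1 *: b^T) *m a%:M + b^T = 0.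
    by rewrite mul_mx_scalar scalerN scalerA mulfV ?gt_eqF // scale1r addNr.
  by rewrite e1 e2 mul0mx add0r mulNmx -scalemxAl addrC.
have pC' : posdef C'.
  split; first by rewrite /C' linearB /= linearZ /= trmx_mul trmxK sC.
  move=> v v0; pose w := row_mx 0 v *m Q1.
  have wE : w = row_mx (- (a^-1 *: (v *m b^T))) v.
    rewrite /w /Q1 mul_row_block !mul0mx !mulmx1 !add0r.
    by rewrite mulmxN -scalemxAr.
  have w0 : w != 0.
    apply: contra v0; rewrite wE => /eqP/(congr1 rsubmx).
    by rewrite row_mxKr linear0 => ->.
  have := pG w w0; rewrite /w trmx_mul !mulmxA -(mulmxA (row_mx 0 v)).
  rewrite -(mulmxA (row_mx 0 v)) E1 mul_row_block tr_row_mx mul_row_col.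
  by rewrite !mul0mx !add0r trmx0 mulmx0 add0r.
have [Q2 EQ2] := IH _ pC'.
pose D : 'M[R]_(1 + n) := block_mx (Num.sqrt a)^-1%:M 0 0 Q2.
exists (D *m Q1).
rewrite trmx_mul !mulmxA -(mulmxA D) -(mulmxA D) E1 /D tr_block_mx !mulmx_block.
rewrite !trmx0 !mulmx0 !mul0mx !addr0 !add0r ?mulmx0 EQ2 tr_scalar_mx -!scalar_mxM.
have s0 : Num.sqrt a != 0 by rewrite gt_eqF // sqrtr_gt0.
have sa : Num.sqrt a ^+ 2 = a by rewrite sqr_sqrtr // ltW.
rewrite (_ : _ * _ * _ = 1); first by rewrite !mul0mx -scalar_mx_block.
by rewrite -[in X in _ * X * _]sa; move: s0; move: (Num.sqrt a) => s s0; field.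
Qed.

Section Metric.
Variables (n : nat) (G : 'M[R]_n).
Hypothesis pG : posdef G.

Lemma posdef_unitmx : G \in unitmx.
Proof.
have [Q /(congr1 determinant)] := posdef_orthonormalize pG.
rewrite !det_mulmx det1 unitmxE unitfE => e.
by apply: contra_eq_neq e => ->; rewrite mulr0 mul0r eq_sym oner_neq0.
Qed.

(** The rows of [Q] form an orthonormal basis for [G], and the inverse metric is the sum of their
    tensor squares; the signs of metric contractions can then be read off basis vector by basis
    vector. *)
Lemma posdef_invmx_gram : exists Q : 'M[R]_n, Q *m G *m Q^T = 1%:M /\ invmx G = Q^T *m Q.
Proof.
have [Q EQ] := posdef_orthonormalize pG; exists Q; split => //.
have E : G *m (Q^T *m Q) = 1%:M.
  by rewrite mulmxA; apply: mulmx1C; rewrite mulmxA.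
by rewrite -[LHS]mulmx1 -E mulKmx // posdef_unitmx.
Qed.

Lemma trmx_invmx_posdef : (invmx G)^T = invmx G.
Proof. by have [Q [_ ->]] := posdef_invmx_gram; rewrite trmx_mul trmxK. Qed.

Lemma invmx_posdef_ge0 (v : 'rV[R]_n) : 0 <= (v *m invmx G *m v^T) 0 0.
Proof.
have [Q [_ ->]] := posdef_invmx_gram.
rewrite !mulmxA -mulmxA -{2}[Q]trmxK -trmx_mul mxE; apply: sumr_ge0 => i _.
by rewrite [_^T i 0]mxE -expr2 sqr_ge0.
Qed.

Lemma trace_invmx_le0 (F : 'M[R]_n) :
  (forall v : 'rV[R]_n, \sum_i \sum_j v 0 i * v 0 j * F i j <= 0) ->
  \sum_i \sum_j invmx G i j * F i j <= 0.
Proof.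
move=> HF; have [Q [_ ->]] := posdef_invmx_gram.
have -> : \sum_i \sum_j (Q^T *m Q) i j * F i j =
    \sum_k \sum_i \sum_j row k Q 0 i * row k Q 0 j * F i j.
  rewrite [RHS]exchange_big; apply: eq_bigr => i _.
  rewrite [RHS]exchange_big; apply: eq_bigr => j _.
  by rewrite mxE mulr_suml; apply: eq_bigr => k _; rewrite !mxE.
by apply: sumr_le0 => k _.
Qed.

Lemma sum_sqr_ge (a : 'I_n -> R) : (\sum_i a i) ^+ 2 <= n%:R * \sum_i a i ^+ 2.
Proof.
suff : 0 <= 2 * (n%:R * \sum_i a i ^+ 2 - (\sum_i a i) ^+ 2).
  by rewrite pmulr_rge0 ?ltr0n // subr_ge0.
have <- : \sum_i \sum_j (a i - a j) ^+ 2 = 2 * (n%:R * \sum_i a i ^+ 2 - (\sum_i a i) ^+ 2).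
  have e i : \sum_j (a i - a j) ^+ 2 = n%:R * a i ^+ 2 + \sum_j a j ^+ 2 - 2 * (a i * \sum_j a j).
    rewrite !mulr_sumr -sumrN -[n in n%:R](card_ord n) mulr_natl -sumr_const -!big_split /=.
    by apply: eq_bigr => j _; ring.
  under eq_bigr do rewrite e.
  rewrite big_split big_split /= -mulr_sumr sumr_const card_ord sumrN -mulr_sumr -mulr_suml.
  by rewrite -mulr_natl; ring.
by apply: sumr_ge0 => i _; apply: sumr_ge0 => j _; exact: sqr_ge0.
Qed.

(** In an orthonormal basis the self-adjoint [B] becomes a symmetric matrix [N] with the same
    traces. Cauchy-Schwarz applies to its diagonal, and the off-diagonal entries only add squares to
    [tr (N^2)]. *)
Lemma sqr_trace_le (B : 'M[R]_n) : (G *m B)^T = G *m B ->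
  (\tr B) ^+ 2 <= n%:R * \tr (B *m B).
Proof.
move=> sB; have [Q [EQ EG]] := posdef_invmx_gram.
pose N := Q *m (G *m B) *m Q^T.
have sN : N^T = N by rewrite /N trmx_mul trmxK [(Q *m _)^T]trmx_mul sB mulmxA.
have QQG : Q^T *m Q *m G = 1%:M by rewrite -EG mulVmx // posdef_unitmx.
have tN : \tr N = \tr B by rewrite /N mxtrace_mulC !mulmxA QQG mul1mx.
have tNN : \tr (N *m N) = \tr (B *m B).
  have -> : N *m N = Q *m (G *m (B *m B)) *m Q^T.
    by rewrite /N -!mulmxA (mulmxA Q^T) (mulmxA (Q^T *m Q)) QQG mul1mx.
  by rewrite mxtrace_mulC !mulmxA QQG mul1mx.
rewrite -tN -tNN; apply: le_trans (sum_sqr_ge (fun i => N i i)) _.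
rewrite ler_wpM2l ?ler0n // /mxtrace; apply: ler_sum => i _.
rewrite [(N *m N) i i]mxE (bigD1 i) //= expr2 lerDl; apply: sumr_ge0 => j _.
by rewrite -{2}sN [N^T _ _]mxE -expr2 sqr_ge0.
Qed.

End Metric.
End PositiveDefinite.

(** * Riemannian geometry in local coordinates *)

Section BochnerAlgebra.
Variables (R : comRingType) (n : nat).
Implicit Types (i j k m : 'I_n).

Lemma sum2C (F : 'I_n -> 'I_n -> R) : \sum_i \sum_j F i j = \sum_i \sum_j F j i.
Proof. exact: exchange_big. Qed.

Lemma sum3C12 (F : 'I_n -> 'I_n -> 'I_n -> R) :
  \sum_i \sum_j \sum_k F i j k = \sum_i \sum_j \sum_k F j i k.
Proof. exact: exchange_big. Qed.

Lemma sum3C23 (F : 'I_n -> 'I_n -> 'I_n -> R) :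
  \sum_i \sum_j \sum_k F i j k = \sum_i \sum_j \sum_k F i k j.
Proof. by apply: eq_bigr => i _; exact: exchange_big. Qed.

Lemma sum2D (F G : 'I_n -> 'I_n -> R) :
  \sum_i \sum_j (F i j + G i j) = \sum_i \sum_j F i j + \sum_i \sum_j G i j.
Proof. by rewrite -big_split; apply: eq_bigr => i _; rewrite big_split. Qed.

Lemma sum3D (F G : 'I_n -> 'I_n -> 'I_n -> R) :
  \sum_i \sum_j \sum_k (F i j k + G i j k) =
  \sum_i \sum_j \sum_k F i j k + \sum_i \sum_j \sum_k G i j k.
Proof. by rewrite -big_split; apply: eq_bigr => i _; rewrite sum2D. Qed.

Lemma eq_sum2 (F G : 'I_n -> 'I_n -> R) : (forall i j, F i j = G i j) ->
  \sum_i \sum_j F i j = \sum_i \sum_j G i j.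
Proof. by move=> FG; apply: eq_bigr => i _; apply: eq_bigr => j _. Qed.

Lemma eq_sum3 (F G : 'I_n -> 'I_n -> 'I_n -> R) : (forall i j k, F i j k = G i j k) ->
  \sum_i \sum_j \sum_k F i j k = \sum_i \sum_j \sum_k G i j k.
Proof. by move=> FG; apply: eq_bigr => i _; exact: eq_sum2. Qed.

(* At a given point, v i stands for X^i, p i j for d_j X^i, q l j i for
   d_l d_j X^i, c k i j for Gamma^k_ij and dc l k i j for d_l Gamma^k_ij; then
   B i j is nabla_j X^i and dB l i j is d_l B^i_j. *)
Variables (v : 'I_n -> R) (p : 'I_n -> 'I_n -> R) (q : 'I_n -> 'I_n -> 'I_n -> R).
Variables (c : 'I_n -> 'I_n -> 'I_n -> R) (dc : 'I_n -> 'I_n -> 'I_n -> 'I_n -> R).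
Hypothesis qC : forall i j a, q i j a = q j i a.
Hypothesis cC : forall a i j, c a i j = c a j i.

Let B i j := p i j + \sum_k c i j k * v k.
Let dB l i j := q l j i + \sum_k (c i j k * p k l + v k * dc l i j k).

Lemma bochner_algebra :
  \sum_i (\sum_j (B i j * p j i + v j * dB i i j) + \sum_j c i i j * \sum_k B j k * v k)
  = \sum_j v j * (\sum_i dB j i i)
    + \sum_j \sum_k v j * v k *
        (\sum_i (dc i i j k - dc j i i k
                 + \sum_m (c m j k * c i i m - c m i k * c i j m)))
    + \sum_i \sum_j B i j * B j i.
Proof.
(* The left-hand side is [A1 + ... + A6]. On the right, the derivative of the trace gives
   [A2 + A5 + A7], the curvature gives [A4 - A7 + A6 - A8], and the trace of the square gives
   [A1 + A3 + A8]. Commuting derivatives enter through [A2], the symmetry of the Christoffel symbols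
   through the last group. *)
pose A1 := \sum_i \sum_j B i j * p j i.
pose A2 := \sum_i \sum_j v j * q i j i.
pose A3 := \sum_i \sum_j \sum_k v j * (c i j k * p k i).
pose A4 := \sum_i \sum_j \sum_k v j * (v k * dc i i j k).
pose A5 := \sum_i \sum_j \sum_k c i i j * p j k * v k.
pose A6 := \sum_i \sum_j \sum_k \sum_m v k * v m * (c i i j * c j k m).
pose A7 := \sum_i \sum_j \sum_k v j * (v k * dc j i i k).
pose A8 := \sum_i \sum_j \sum_k \sum_m v j * v k * (c m i k * c i j m).
have EL : \sum_i (\sum_j (B i j * p j i + v j * dB i i j) + \sum_j c i i j * \sum_k B j k * v k)
    = A1 + A2 + A3 + A4 + A5 + A6.
  rewrite big_split /= sum2D -!addrA; congr (_ + _).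
  have -> : \sum_i \sum_j v j * dB i i j = A2 + A3 + A4.
    rewrite /A2 /A3 /A4 -addrA -sum3D -sum2D; apply: eq_sum2 => i j.
    rewrite /dB mulrDr mulr_sumr; congr (_ + _).
    by apply: eq_bigr => k _; ring.
  rewrite -!addrA; do 3 congr (_ + _); rewrite -sum3D.
  apply: eq_sum2 => i j; rewrite mulr_sumr; apply: eq_bigr => k _.
  rewrite /B mulrDl mulrDr mulrA; congr (_ + _).
  by rewrite mulr_suml mulr_sumr; apply: eq_bigr => m _; ring.
have ER1 : \sum_j v j * (\sum_i dB j i i) = A2 + A5 + A7.
  have e2 : A2 = \sum_j \sum_i v j * q j i i.
    by rewrite /A2 sum2C; apply: eq_sum2 => j i; rewrite qC.
  have e5 : A5 = \sum_j \sum_i \sum_k c i i k * p k j * v j.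
    by rewrite /A5 sum3C23 sum3C12.
  have e7 : A7 = \sum_j \sum_i \sum_k v j * (v k * dc j i i k) by rewrite /A7 sum3C12.
  rewrite e2 e5 e7 -addrA -sum3D -sum2D; apply: eq_bigr => j _; rewrite mulr_sumr.
  apply: eq_bigr => i _; rewrite /dB mulrDr mulr_sumr; congr (_ + _).
  by apply: eq_bigr => k _; ring.
have ER2 : \sum_j \sum_k v j * v k * (\sum_i (dc i i j k - dc j i i k
    + \sum_m (c m j k * c i i m - c m i k * c i j m))) = A4 - A7 + A6 - A8.
  have e6 : A6 = \sum_i \sum_j \sum_k \sum_m v j * v k * (c m j k * c i i m).
    apply: eq_bigr => i _; rewrite sum3C12; apply: eq_bigr => j _.
    rewrite sum2C; apply: eq_sum2 => k m; ring.
  transitivity (\sum_i \sum_j \sum_k v j * v k * ((dc i i j k - dc j i i k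
    + \sum_m (c m j k * c i i m - c m i k * c i j m)))).
    rewrite sum3C12; apply: eq_bigr => j _; rewrite sum2C; apply: eq_bigr => k _.
    by rewrite mulr_sumr.
  rewrite e6; set X := (X in A4 - A7 + X - A8).
  have -> : A4 - A7 + X - A8 = A4 + X - (A7 + A8) by ring.
  apply: (addIr (A7 + A8)); rewrite subrK /A4 /X /A7 /A8 -!sum3D.
  apply: eq_sum3 => i j k; rewrite mulrDr mulr_sumr.
  have -> : \sum_m v j * v k * (c m j k * c i i m) =
     \sum_m v j * v k * (c m j k * c i i m - c m i k * c i j m) +
     \sum_m v j * v k * (c m i k * c i j m).
    by rewrite -big_split; apply: eq_bigr => m _; rewrite /=; ring.
  ring.
have ER3 : \sum_i \sum_j B i j * B j i = A1 + A3 + A8.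
  have e3 : A3 = \sum_i \sum_j \sum_k p i j * (c j i k * v k).
    rewrite /A3 sum3C23 sum3C12; apply: eq_sum3 => i j k.
    by rewrite (cC j k i); ring.
  have e8 : A8 = \sum_i \sum_j (\sum_m c i j m * v m) * (\sum_k c j i k * v k).
    apply: eq_bigr => i _; rewrite sum3C23 sum3C12; apply: eq_bigr => m _.
    rewrite mulr_suml; apply: eq_bigr => j _; rewrite mulr_sumr; apply: eq_bigr => k _.
    by rewrite (cC i j m); ring.
  rewrite e3 e8 /A1 -sum2D -sum2D; apply: eq_sum2 => i j.
  by rewrite /= -mulr_sumr -addrA -mulrDl -mulrDr.
rewrite EL ER1 ER2 ER3; ring.
Qed.

End BochnerAlgebra.

Section InverseSums.
Variables (R : realType) (n : nat) (A : 'M[R]_n) (a : 'I_n -> R).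
Hypothesis uA : A \in unitmx.

Lemma sum_mulVmx i : \sum_l invmx A i l * (\sum_j A l j * a j) = a i.
Proof.
transitivity ((invmx A *m (A *m (\col_j a j))) i 0).
  by rewrite mxE; apply: eq_bigr => l _; rewrite mxE; congr (_ * _);
    apply: eq_bigr => j _; rewrite mxE.
by rewrite mulKmx // mxE.
Qed.

Lemma sum_mulmxV i : \sum_l A i l * (\sum_j invmx A l j * a j) = a i.
Proof.
transitivity ((A *m (invmx A *m (\col_j a j))) i 0).
  by rewrite mxE; apply: eq_bigr => l _; rewrite mxE; congr (_ * _);
    apply: eq_bigr => j _; rewrite mxE.
by rewrite mulKVmx // mxE.
Qed.

End InverseSums.

(* The vectors e i only serve as commuting directions of differentiation: V is
   the coordinate space, or coordinate space times time with e i spatial. *)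
Section LocalGeometry.
Variables (R : realType) (V : normedModType R) (n : nat) (e : 'I_n -> V).
Variable (G : V -> 'M[R]_n).
Implicit Types (i j k l m : 'I_n) (f : V -> R) (X : 'I_n -> V -> R) (x : V).

Definition lchr k i j x : R :=
  2^-1 * \sum_l invmx (G x) k l *
    ('D_(e i) (fun y => G y j l) x + 'D_(e j) (fun y => G y i l) x
     - 'D_(e l) (fun y => G y i j) x).

Definition lgrad f i x : R := \sum_j invmx (G x) i j * 'D_(e j) f x.

Definition ldiv X x : R := \sum_i ('D_(e i) (X i) x + \sum_j lchr i i j x * X j x).

Definition llap f x : R := ldiv (lgrad f) x.

Definition lric j k x : R := \sum_i
  ('D_(e i) (lchr i j k) x - 'D_(e j) (lchr i i k) x
   + \sum_m (lchr m j k x * lchr i i m x - lchr m i k x * lchr i j m x)).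

(** The component [i] of the covariant derivative of [X] along [e j]. Its trace is [ldiv]; for
    [X = lgrad f] it is the Hessian with one index raised. *)
Definition lcov X i j x : R := 'D_(e j) (X i) x + \sum_k lchr i j k x * X k x.

Definition lnorm2 f x : R := \sum_i 'D_(e i) f x * lgrad f i x.

Variable U : set V.
Hypothesis Uo : open U.
Hypothesis sG : forall i j, smooth_in U (fun x => G x i j).
Hypothesis pG : forall x, U x -> posdef (G x).

Lemma G_sym x i j : U x -> G x i j = G x j i.
Proof. by move=> /pG[sGx _]; rewrite -{1}sGx mxE. Qed.

Lemma smooth_invG i j : smooth_in U (fun x => invmx (G x) i j).
Proof. by apply: smooth_invmx => // x Ux; exact: posdef_unitmx (pG Ux). Qed.

Lemma invG_sym x i j : U x -> invmx (G x) i j = invmx (G x) j i.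
Proof. by move=> Ux; rewrite -{1}(trmx_invmx_posdef (pG Ux)) mxE. Qed.

Lemma smooth_lchr k i j : smooth_in U (lchr k i j).
Proof.
apply: (smoothM Uo (smooth_cst Uo _)).
apply: (smooth_sum Uo) => l; apply: (smoothM Uo (smooth_invG k l)).
apply: (smoothB Uo); last exact: smooth_in_derive.
by apply: (smoothD Uo); exact: smooth_in_derive.
Qed.

Lemma lchr_sym k i j x : U x -> lchr k i j x = lchr k j i x.
Proof.
move=> Ux; rewrite /lchr.
under eq_bigr => l _ do
  rewrite (eq_on_derive Uo (e l) (fun y => @G_sym y i j) Ux) [X in X - _]addrC.
by [].
Qed.

Lemma smooth_lgrad f i : smooth_in U f -> smooth_in U (lgrad f i).
Proof.
move=> sf; apply: (smooth_sum Uo) => j.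
by apply: (smoothM Uo (smooth_invG i j)); exact: smooth_in_derive.
Qed.

Lemma smooth_lcov X i j : (forall i, smooth_in U (X i)) -> smooth_in U (lcov X i j).
Proof.
move=> sX; apply: (smoothD Uo); first exact: smooth_in_derive.
by apply: (smooth_sum Uo) => k; exact: (smoothM Uo (smooth_lchr _ _ _) (sX _)).
Qed.

Lemma smooth_ldiv X : (forall i, smooth_in U (X i)) -> smooth_in U (ldiv X).
Proof. by move=> sX; apply: (smooth_sum Uo) => i; exact: smooth_lcov. Qed.

Lemma smooth_lnorm2 f : smooth_in U f -> smooth_in U (lnorm2 f).
Proof.
move=> sf; apply: (smooth_sum Uo) => i; apply: (smoothM Uo (smooth_in_derive _ sf)).
exact: smooth_lgrad.
Qed.

Lemma derive_lcov X i j l x : (forall i, smooth_in U (X i)) -> U x ->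
  'D_(e l) (lcov X i j) x = 'D_(e l) ('D_(e j) (X i)) x +
    \sum_k (lchr i j k x * 'D_(e l) (X k) x + X k x * 'D_(e l) (lchr i j k) x).
Proof.
move=> sX Ux.
have sT k : smooth_in U (fun y => lchr i j k y * X k y).
  exact: (smoothM Uo (smooth_lchr _ _ _) (sX _)).
rewrite (derive_add_in (e l) (smooth_in_derive (e j) (sX i)) (smooth_sum Uo _ _ sT) Ux).
rewrite (derive_sum_in Uo (e l) sT Ux); congr (_ + _); apply: eq_bigr => k _.
exact: (derive_mul_in (e l) (smooth_lchr i j k) (sX k) Ux).
Qed.

(* div (nabla_X X) = X (div X) + Ric(X, X) + tr ((nabla X)^2) *)
Lemma ldiv_cov X x : (forall i, smooth_in U (X i)) -> U x ->
  ldiv (fun i y => \sum_j lcov X i j y * X j y) x =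
    \sum_j X j x * 'D_(e j) (ldiv X) x
    + \sum_j \sum_k X j x * X k x * lric j k x
    + \sum_i \sum_j lcov X i j x * lcov X j i x.
Proof.
move=> sX Ux.
have sB i j := smooth_lcov i j sX.
have sT i j : smooth_in U (fun y => lcov X i j y * X j y) := smoothM Uo (sB i j) (sX j).
have -> : \sum_j X j x * 'D_(e j) (ldiv X) x = \sum_j X j x * \sum_i 'D_(e j) (lcov X i i) x.
  apply: eq_bigr => j _; congr (_ * _).
  exact: (derive_sum_in Uo (e j) (fun i => sB i i) Ux).
have -> : ldiv (fun i y => \sum_j lcov X i j y * X j y) x =
  \sum_i (\sum_j (lcov X i j x * 'D_(e i) (X j) x + X j x * 'D_(e i) (lcov X i j) x)
    + \sum_j lchr i i j x * \sum_k lcov X j k x * X k x).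
  apply: eq_bigr => i _; congr (_ + _).
  rewrite (derive_sum_in Uo (e i) (sT i) Ux); apply: eq_bigr => j _.
  exact: (derive_mul_in (e i) (sB i j) (sX j) Ux).
pose q l j i := 'D_(e l) ('D_(e j) (X i)) x.
have qC l j i : q l j i = q j l i by exact: derive_comm Uo (sX i) Ux.
have cC a i j : lchr a i j x = lchr a j i x by exact: lchr_sym.
have := bochner_algebra (fun i => X i x) (fun i j => 'D_(e j) (X i) x)
  (fun l i j k => 'D_(e l) (lchr i j k) x) qC cC.
have eD l i j : 'D_(e l) (lcov X i j) x = q l j i +
    \sum_k (lchr i j k x * 'D_(e l) (X k) x + X k x * 'D_(e l) (lchr i j k) x).
  exact: derive_lcov.
move=> H; under eq_bigr => i _ do under eq_bigr => j _ do rewrite eD.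
under [in RHS]eq_bigr => j _ do under eq_bigr => i _ do rewrite eD.
exact: H.
Qed.

Lemma ldiv_eq_on X Y x : (forall i y, U y -> X i y = Y i y) -> U x -> ldiv X x = ldiv Y x.
Proof.
move=> XY Ux; apply: eq_bigr => i _; rewrite (eq_on_derive Uo (e i) (XY i) Ux).
by congr (_ + _); apply: eq_bigr => j _; rewrite XY.
Qed.

Lemma ldiv_scale (a : R) X x : (forall i, smooth_in U (X i)) -> U x ->
  ldiv (fun i y => a * X i y) x = a * ldiv X x.
Proof.
move=> sX Ux; rewrite /ldiv mulr_sumr; apply: eq_bigr => i _.
rewrite (derive_scale_in Uo a (e i) (sX i) Ux) mulrDr mulr_sumr; congr (_ + _).
by apply: eq_bigr => j _; rewrite mulrCA.
Qed.

Lemma lower_lgrad f i x : U x -> \sum_l G x i l * lgrad f l x = 'D_(e i) f x.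
Proof.
move=> Ux; exact: (sum_mulmxV (fun j => 'D_(e j) f x) (posdef_unitmx (pG Ux)) i).
Qed.

(** These are the Christoffel symbols of the first kind, free of the inverse metric. *)
Lemma lower_lchr i j k x : U x -> \sum_l G x i l * lchr l j k x =
  2^-1 * ('D_(e j) (fun y => G y k i) x + 'D_(e k) (fun y => G y j i) x
     - 'D_(e i) (fun y => G y j k) x).
Proof.
move=> Ux; have uG := posdef_unitmx (pG Ux).
rewrite -(sum_mulmxV (fun l => 2^-1 * ('D_(e j) (fun y => G y k l) x
  + 'D_(e k) (fun y => G y j l) x - 'D_(e l) (fun y => G y j k) x)) uG i).
apply: eq_bigr => l _; congr (_ * _); rewrite /lchr mulr_sumr.
by apply: eq_bigr => m _; rewrite mulrCA.
Qed.

Lemma derive_G_sym i j l x : U x ->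
  'D_(e l) (fun y => G y i j) x = 'D_(e l) (fun y => G y j i) x.
Proof. by move=> Ux; exact: (eq_on_derive Uo (e l) (fun y => @G_sym y i j) Ux). Qed.

Section Gradient.
Variable f : V -> R.
Hypothesis sf : smooth_in U f.
Let X := lgrad f.
Let sX i : smooth_in U (X i) := smooth_lgrad i sf.

(** Obtained by differentiating [lower_lgrad], which trades the derivative of the inverse metric for
    one of [G]. *)
Lemma lower_derive_lgrad i j x : U x ->
  \sum_l G x i l * 'D_(e j) (X l) x =
  'D_(e j) ('D_(e i) f) x - \sum_l X l x * 'D_(e j) (fun y => G y i l) x.
Proof.
move=> Ux; rewrite -(eq_on_derive Uo (e j) (fun y => @lower_lgrad f i y) Ux).
have sT l : smooth_in U (fun y => G y i l * X l y) := smoothM Uo (sG i l) (sX l).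
rewrite (derive_sum_in Uo (e j) sT Ux) -sumrB; apply: eq_bigr => l _.
by rewrite (derive_mul_in (e j) (sG i l) (sX l) Ux) addrK.
Qed.

(** The bracket is twice a Christoffel symbol of the first kind, symmetric in [i] and [j] like the
    second derivative of [f]; hence [hessian_sym]. *)
Lemma lower_hessian i j x : U x -> \sum_l G x i l * lcov X l j x =
  'D_(e j) ('D_(e i) f) x - 2^-1 * \sum_k X k x *
    ('D_(e j) (fun y => G y i k) x + 'D_(e i) (fun y => G y j k) x
     - 'D_(e k) (fun y => G y i j) x).
Proof.
move=> Ux.
have -> : \sum_l G x i l * lcov X l j x =
    \sum_l G x i l * 'D_(e j) (X l) x + \sum_k X k x * (\sum_l G x i l * lchr l j k x).
  under [X in _ + X]eq_bigr => k _ do rewrite mulr_sumr.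
  rewrite [X in _ + X]exchange_big -big_split; apply: eq_bigr => l _ /=.
  rewrite /lcov mulrDr mulr_sumr; congr (_ + _); apply: eq_bigr => k _.
  ring.
rewrite lower_derive_lgrad // -addrA; congr (_ + _).
rewrite mulr_sumr -!sumrN -big_split; apply: eq_bigr => k _ /=.
rewrite (lower_lchr i j k Ux) (derive_G_sym i k j Ux) (derive_G_sym j i k Ux).
by move: (derive _ _ _) (derive _ _ _) (derive _ _ _) (X k x) => a b c w; field.
Qed.

Lemma hessian_sym i j x : U x ->
  \sum_l G x i l * lcov X l j x = \sum_l G x j l * lcov X l i x.
Proof.
move=> Ux; rewrite (lower_hessian i j Ux) (lower_hessian j i Ux).
rewrite (derive_comm (e j) (e i) Uo sf Ux).
under eq_bigr => k _ do rewrite (derive_G_sym i j k Ux) [X in X - _]addrC.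
by [].
Qed.

Lemma derive_lnorm2 j x : U x -> 'D_(e j) (lnorm2 f) x =
  2 * \sum_i X i x * \sum_l G x i l * lcov X l j x.
Proof.
move=> Ux.
have sT i : smooth_in U (fun y => 'D_(e i) f y * X i y).
  exact: (smoothM Uo (smooth_in_derive _ sf) (sX i)).
rewrite (derive_sum_in Uo (e j) sT Ux).
under eq_bigr => i _ do rewrite (derive_mul_in (e j) (smooth_in_derive (e i) sf) (sX i) Ux).
rewrite big_split /=.
have -> : \sum_i 'D_(e i) f x * 'D_(e j) (X i) x =
    \sum_i X i x * ('D_(e j) ('D_(e i) f) x - \sum_l X l x * 'D_(e j) (fun y => G y i l) x).
  under eq_bigr => i _ do rewrite -(lower_lgrad f i Ux) mulr_suml.
  rewrite exchange_big; apply: eq_bigr => l _ /=.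
  rewrite -lower_derive_lgrad // mulr_sumr; apply: eq_bigr => i _.
  by rewrite (G_sym i l Ux) mulrAC mulrC mulrA.
have -> : \sum_i X i x * \sum_l G x i l * lcov X l j x =
    \sum_i X i x * 'D_(e j) ('D_(e i) f) x -
    2^-1 * \sum_i \sum_k X i x * X k x * 'D_(e j) (fun y => G y i k) x.
  rewrite mulr_sumr -sumrB.
  (* The part of the Christoffel symbols that is antisymmetric in [i] and [k] disappears when
     contracted with [X^i X^k]; what is left is the derivative of the metric along [e j]. *)
  have E : \sum_i \sum_k X i x * X k x *
     ('D_(e i) (fun y => G y j k) x - 'D_(e k) (fun y => G y i j) x) = 0.
    pose S := \sum_i \sum_k X i x * X k x * 'D_(e i) (fun y => G y j k) x.
    have S2 : S = \sum_i \sum_k X i x * X k x * 'D_(e k) (fun y => G y i j) x.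
      rewrite /S sum2C; apply: eq_sum2 => i k.
      by rewrite [X k x * _]mulrC (derive_G_sym j i k Ux).
    transitivity (S - S); last by rewrite subrr.
    rewrite {2}S2 /S -sumrB; apply: eq_bigr => i _; rewrite -sumrB.
    by apply: eq_bigr => k _; rewrite mulrBr.
  have Ei i : X i x * \sum_l G x i l * lcov X l j x =
     (X i x * 'D_(e j) ('D_(e i) f) x -
      2^-1 * \sum_k X i x * X k x * 'D_(e j) (fun y => G y i k) x) -
     2^-1 * \sum_k X i x * X k x *
       ('D_(e i) (fun y => G y j k) x - 'D_(e k) (fun y => G y i j) x).
    rewrite (lower_hessian i j Ux) mulrBr -addrA -opprD -mulrDr -big_split /=.
    congr (_ - _); rewrite mulrCA mulr_sumr; congr (_ * _); apply: eq_bigr => k _.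
    by move: (derive _ _ _) (derive _ _ _) (derive _ _ _) (X k x) (X i x) => a b c w w'; ring.
  under eq_bigr => i _ do rewrite Ei.
  have E' : \sum_i 2^-1 * (\sum_k X i x * X k x *
       ('D_(e i) (fun y => G y j k) x - 'D_(e k) (fun y => G y i j) x)) = 0.
    by rewrite -mulr_sumr E mulr0.
  by rewrite [LHS]sumrB E' subr0.
rewrite mulrBr mulrA divff ?mul1r; last by rewrite pnatr_eq0.
have -> : \sum_i X i x * ('D_(e j) ('D_(e i) f) x -
       \sum_l X l x * 'D_(e j) (fun y => G y i l) x) =
   \sum_i X i x * 'D_(e j) ('D_(e i) f) x -
    \sum_i \sum_k X i x * X k x * 'D_(e j) (fun y => G y i k) x.
  rewrite -sumrB; apply: eq_bigr => i _; rewrite mulrBr mulr_sumr; congr (_ - _).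
  by apply: eq_bigr => k _; rewrite mulrA.
ring.
Qed.

Lemma lgrad_lnorm2 i x : U x -> lgrad (lnorm2 f) i x = 2 * \sum_j lcov X i j x * X j x.
Proof.
move=> Ux; rewrite /lgrad; under eq_bigr => j _ do rewrite derive_lnorm2 // mulrCA.
rewrite -mulr_sumr; congr (_ * _).
transitivity (\sum_k \sum_j invmx (G x) i j * \sum_l G x j l * (X k x * lcov X l k x)).
  rewrite [RHS]exchange_big; apply: eq_bigr => j _ /=; rewrite mulr_sumr.
  apply: eq_bigr => k _; rewrite hessian_sym // mulr_sumr; congr (_ * _).
  by apply: eq_bigr => l _; rewrite mulrCA.
apply: eq_bigr => k _.
by rewrite (sum_mulVmx (fun l => X k x * lcov X l k x) (posdef_unitmx (pG Ux)) i) mulrC.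
Qed.

Lemma bochner x : U x -> llap (lnorm2 f) x =
  2 * (\sum_j X j x * 'D_(e j) (llap f) x
       + \sum_j \sum_k X j x * X k x * lric j k x
       + \sum_i \sum_j lcov X i j x * lcov X j i x).
Proof.
move=> Ux.
have sY i : smooth_in U (fun y => \sum_j lcov X i j y * X j y).
  by apply: (smooth_sum Uo) => j; exact: (smoothM Uo (smooth_lcov _ _ sX) (sX _)).
have E := ldiv_cov sX Ux.
transitivity (2 * ldiv (fun i y => \sum_j lcov X i j y * X j y) x); last by rewrite E.
rewrite -(ldiv_scale 2 sY Ux).
exact: (ldiv_eq_on (fun i y => @lgrad_lnorm2 i y) Ux).
Qed.

(* Cauchy-Schwarz for the Hessian, a g-self-adjoint endomorphism of trace Lap f. *)
Lemma sqr_llap_le x : U x ->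
  (llap f x) ^+ 2 <= n%:R * \sum_i \sum_j lcov X i j x * lcov X j i x.
Proof.
move=> Ux; pose B := \matrix_(i, j) lcov X i j x.
have sB : (G x *m B)^T = G x *m B.
  apply/matrixP => i j; rewrite !mxE.
  under eq_bigr do rewrite mxE; under [in RHS]eq_bigr do rewrite mxE.
  exact: hessian_sym.
have := sqr_trace_le (pG Ux) sB.
have -> : \tr B = llap f x by apply: eq_bigr => i _; rewrite mxE.
have -> // : \tr (B *m B) = \sum_i \sum_j lcov X i j x * lcov X j i x.
by apply: eq_bigr => i _; rewrite mxE; apply: eq_bigr => j _; rewrite !mxE.
Qed.

End Gradient.
End LocalGeometry.

(* The coefficient 1/2 is admissible because the quadratic form
   L^2 - 3/2 L W + W^2 is positive definite. *)
Lemma harnack_algebra (R : realType) (n : nat) (L W T B2 : R) :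
  0 <= W -> 0 < T -> 0 <= B2 -> L ^+ 2 <= n%:R * B2 -> n%:R < T * (L + 2 * W) ->
  L - 2^-1 * W - 2 * T * B2 <= 0.
Proof.
move=> W0 T0 B0 LB nT.
have TB : 0 <= T * B2 by rewrite mulr_ge0 // ltW.
have [LW|LW] := leP L (2^-1 * W); first by nra.
have L0 : 0 < L by apply: le_lt_trans LW; rewrite mulr_ge0 // invr_ge0.
have n0 : 0 < n%:R :> R.
  rewrite lt_neqAle ler0n andbT eq_sym; apply/eqP => n0.
  by move: LB; rewrite n0 mul0r leNgt exprn_gt0.
(* After multiplication by [n], the factor [n] in front of the positive [L - W / 2] is enlarged to
   [T (L + 2 W)]; the quadratic form bounds the product by [2 T L^2], and [L^2 <= n B2]
   concludes. *)
rewrite -(pmulr_rle0 _ n0).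
have h1 : n%:R * (L - 2^-1 * W) <= T * (L + 2 * W) * (L - 2^-1 * W).
  by rewrite ler_wpM2r ?subr_ge0 // ltW.
have h2 : T * ((L + 2 * W) * (L - 2^-1 * W)) <= T * (2 * L ^+ 2).
  rewrite ler_pM2l //.
  suff : 0 <= (L - 3 / 4 * W) ^+ 2 + 7 / 16 * W ^+ 2 by nra.
  by rewrite addr_ge0 ?sqr_ge0 // mulr_ge0 ?sqr_ge0.
have h3 : T * (2 * L ^+ 2) <= T * (2 * (n%:R * B2)) by rewrite ler_pM2l // ler_pM2l.
nra.
Qed.

(** * Stationary metrics, parabolic calculus and the local Harnack quantity *)

Section TimeInvariant.
Variables (R : realType) (V : normedModType R) (tau : V).

(** [tau] is the direction of time. A metric constant along it has Christoffel symbols constant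
    along it, so ['D_tau] commutes with the gradient and the Laplacian. *)
Definition tau_invariant (T : Type) (h : V -> T) := forall s y, h (s *: tau + y) = h y.

Lemma tau_invariant_derive (h : V -> R) v : tau_invariant h -> tau_invariant ('D_v h).
Proof.
move=> hi s y; rewrite /derive; set g1 := fun k => k^-1 *: _; set g2 := fun k => k^-1 *: _.
suff -> : g1 = g2 by [].
by rewrite funeqE /g1 /g2 => k /=; rewrite addrCA !hi.
Qed.

Lemma derive_tau_invariant (h : V -> R) y : tau_invariant h -> 'D_tau h y = 0.
Proof.
move=> hi; rewrite -(@derive_cst R V R (h y) y tau) /derive.
set g1 := fun k => k^-1 *: _; set g2 := fun k => k^-1 *: _.
suff -> : g1 = g2 by [].
by rewrite funeqE /g1 /g2 => k /=; rewrite hi.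
Qed.
End TimeInvariant.

Section Parabolic.
Variables (R : realType) (V : normedModType R) (n : nat) (e : 'I_n -> V) (tau : V).
Variables (G : V -> 'M[R]_n) (U : set V).
Hypothesis Uo : open U.
Hypothesis sG : forall i j, smooth_in U (fun x => G x i j).
Hypothesis pG : forall x, U x -> posdef (G x).
Hypothesis Gtau : tau_invariant tau G.

Local Notation Chr := (lchr e G).
Local Notation Grad := (lgrad e G).
Local Notation Lap := (llap e G).
Local Notation Nrm2 := (lnorm2 e G).
Local Notation Ric := (lric e G).
Implicit Types (f g h : V -> R) (x y : V).

Lemma derive_tau_lgrad f i x : smooth_in U f -> U x ->
  'D_tau (Grad f i) x = Grad ('D_tau f) i x.
Proof.
move=> sf Ux.
have sD j := smooth_in_derive (e j) sf.
have sT j := smoothM Uo (smooth_invG Uo sG pG i j) (sD j).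
rewrite (derive_sum_in Uo tau sT Ux); apply: eq_bigr => j _.
rewrite (derive_mul_in tau (smooth_invG Uo sG pG i j) (sD j) Ux).
rewrite (derive_comm (e j) tau Uo sf Ux).
rewrite [X in _ + _ * X](@derive_tau_invariant R V) ?mulr0 ?addr0 //.
by move=> s y; rewrite Gtau.
Qed.

Lemma tau_invariant_lchr k i j : tau_invariant tau (Chr k i j).
Proof.
move=> s y; rewrite /lchr Gtau; congr (_ * _); apply: eq_bigr => l _.
have Gi a b : tau_invariant tau (fun y => G y a b) by move=> r z; rewrite Gtau.
by rewrite !(tau_invariant_derive _ (Gi _ _)).
Qed.

Lemma derive_tau_llap f x : smooth_in U f -> U x ->
  'D_tau (Lap f) x = Lap ('D_tau f) x.
Proof.
move=> sf Ux.
have sX i := smooth_lgrad e Uo sG pG i sf.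
have sC i j := smoothM Uo (smooth_lchr e Uo sG pG i i j) (sX j).
have sCs i := smooth_sum Uo (index_enum 'I_n) xpredT (sC i).
have sD i := smoothD Uo (smooth_in_derive (e i) (sX i)) (sCs i).
rewrite /llap (derive_sum_in Uo tau sD Ux); apply: eq_bigr => i _.
rewrite (derive_add_in tau (smooth_in_derive (e i) (sX i)) (sCs i) Ux).
rewrite (derive_sum_in Uo tau (sC i) Ux); congr (_ + _).
  rewrite (derive_comm (e i) tau Uo (sX i) Ux).
  exact: (eq_on_derive Uo (e i) (fun y => @derive_tau_lgrad f i y sf) Ux).
apply: eq_bigr => j _.
rewrite (derive_mul_in tau (smooth_lchr e Uo sG pG i i j) (sX j) Ux) derive_tau_lgrad //.
by rewrite (derive_tau_invariant _ (tau_invariant_lchr _ _ _)) mulr0 addr0.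
Qed.

Lemma sum_lgradC f g x : U x -> \sum_i 'D_(e i) f x * Grad g i x =
  \sum_i Grad f i x * 'D_(e i) g x.
Proof.
move=> Ux; under eq_bigr => i _ do rewrite mulr_sumr.
rewrite exchange_big; apply: eq_bigr => j _ /=; rewrite mulr_suml.
by apply: eq_bigr => i _; rewrite (invG_sym pG i j Ux); ring.
Qed.

Lemma derive_tau_lnorm2 f x : smooth_in U f -> U x ->
  'D_tau (Nrm2 f) x = 2 * \sum_i Grad f i x * 'D_(e i) ('D_tau f) x.
Proof.
move=> sf Ux.
have sX i := smooth_lgrad e Uo sG pG i sf.
have sD i := smooth_in_derive (e i) sf.
have sT i := smoothM Uo (sD i) (sX i).
rewrite (derive_sum_in Uo tau sT Ux).
under eq_bigr => i _ do rewrite (derive_mul_in tau (sD i) (sX i) Ux) (derive_tau_lgrad i sf Ux)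
  (derive_comm (e i) tau Uo sf Ux).
by rewrite big_split /= sum_lgradC // mulr_natl mulr2n.
Qed.

Lemma lnorm2_ge0 f x : U x -> 0 <= Nrm2 f x.
Proof.
move=> Ux; have := invmx_posdef_ge0 (pG Ux) (\row_i 'D_(e i) f x).
rewrite mxE; under eq_bigr => j _ do rewrite !mxE mulr_suml.
rewrite exchange_big /=; congr (0 <= _); apply: eq_bigr => i _; rewrite mulr_sumr.
by apply: eq_bigr => j _; rewrite !mxE mulrA.
Qed.

Lemma hessian_norm2_ge0 f x : smooth_in U f -> U x ->
  0 <= \sum_i \sum_j lcov e G (Grad f) i j x * lcov e G (Grad f) j i x.
Proof.
move=> sf Ux; have [n0|n0] := posnP n.
  by rewrite big1 // => i; have := ltn_ord i; rewrite {2}n0.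
have := sqr_llap_le e Uo sG pG sf Ux; rewrite -(pmulr_rge0 _ (_ : 0 < n%:R)) ?ltr0n //.
exact: le_trans (sqr_ge0 _).
Qed.

Section Combination.
Variables (f g T c r : V -> R).
Hypotheses (sf : smooth_in U f) (sg : smooth_in U g) (sT : smooth_in U T).
Hypotheses (sc : smooth_in U c) (sr : smooth_in U r).
Hypothesis T0 : forall i y, U y -> 'D_(e i) T y = 0.
Hypothesis c0 : forall i y, U y -> 'D_(e i) c y = 0.
Hypothesis r0 : forall i y, U y -> 'D_(e i) r y = 0.
(** [T], [c] and [r] are functions of time alone, hence constants for the gradient and the
    Laplacian. With the constants 1, 1 and 0 the same lemmas give the additivity of the
    Laplacian. *)
Let H y := T y * g y + (c y * f y + r y).

Lemma smooth_comb : smooth_in U H.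
Proof.
apply: (smoothD Uo (smoothM Uo sT sg)).
exact: (smoothD Uo (smoothM Uo sc sf) sr).
Qed.

Lemma derive_comb v x : U x -> 'D_v H x =
  T x * 'D_v g x + g x * 'D_v T x + (c x * 'D_v f x + f x * 'D_v c x + 'D_v r x).
Proof.
move=> Ux; rewrite (derive_add_in v (smoothM Uo sT sg) (smoothD Uo (smoothM Uo sc sf) sr) Ux).
rewrite (derive_mul_in v sT sg Ux) (derive_add_in v (smoothM Uo sc sf) sr Ux).
by rewrite (derive_mul_in v sc sf Ux).
Qed.

Lemma derive_space_comb i x : U x ->
  'D_(e i) H x = T x * 'D_(e i) g x + c x * 'D_(e i) f x.
Proof. by move=> Ux; rewrite (derive_comb _ Ux) (T0 i Ux) (c0 i Ux) (r0 i Ux) !mulr0 !addr0. Qed.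

Lemma llap_comb x : U x -> Lap H x = T x * Lap g x + c x * Lap f x.
Proof.
move=> Ux.
have sX i := smooth_lgrad e Uo sG pG i sf.
have sY i := smooth_lgrad e Uo sG pG i sg.
have E i y : U y -> Grad H i y = T y * Grad g i y + c y * Grad f i y.
  move=> Uy; rewrite /lgrad !mulr_sumr -big_split; apply: eq_bigr => j _ /=.
  by rewrite (derive_space_comb j Uy) mulrDr mulrCA [X in _ + X]mulrCA.
rewrite /llap (ldiv_eq_on e G Uo E Ux) /ldiv !mulr_sumr -big_split /=.
apply: eq_bigr => i _.
rewrite (derive_add_in (e i) (smoothM Uo sT (sY i)) (smoothM Uo sc (sX i)) Ux).
rewrite (derive_mul_in (e i) sT (sY i) Ux) (derive_mul_in (e i) sc (sX i) Ux).
move: (T0 i Ux) (c0 i Ux).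
move: ('D_(e i) T x) ('D_(e i) c x) ('D_(e i) (Grad g i) x) ('D_(e i) (Grad f i) x).
move=> dT dc dg df -> ->; rewrite !mulr0 !addr0 !mulrDr !mulr_sumr addrACA -big_split.
by congr (_ + _); apply: eq_bigr => j _ /=; ring.
Qed.

End Combination.

Section HarnackQuantity.
Variables (f T : V -> R) (K a : R).
Hypotheses (sf : smooth_in U f) (sT : smooth_in U T).
Hypothesis T0 : forall i y, U y -> 'D_(e i) T y = 0.
Hypothesis heat : forall y, U y -> 'D_tau f y = Lap f y + Nrm2 f y.

Let c y := 5 / 2 + 2 * K * T y.
Let r y := - (a * c y) - n%:R.
Let g y := 'D_tau f y + Nrm2 f y.
(** With [T] the elapsed time and [a = ln A], this is [T (f_t + W) - c (a - f) - n], arranged as a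
    combination whose coefficients depend on time only. *)
Definition local_harnack y := T y * g y + (c y * f y + r y).

Let sc : smooth_in U c :=
  smoothD Uo (smooth_cst Uo (5 / 2)) (smoothM Uo (smooth_cst Uo (2 * K)) sT).
Let sr : smooth_in U r.
Proof.
exact: (smoothB Uo (smoothN Uo (smoothM Uo (smooth_cst Uo a) sc)) (smooth_cst Uo n%:R)).
Qed.
Let sg : smooth_in U g := smoothD Uo (smooth_in_derive tau sf) (smooth_lnorm2 e Uo sG pG sf).

Lemma smooth_local_harnack : smooth_in U local_harnack.
Proof. exact: smooth_comb sf sg sT sc sr. Qed.

Let Dc v y : U y -> 'D_v c y = 2 * K * 'D_v T y.
Proof.
move=> Uy; have sKT := smoothM Uo (smooth_cst Uo (2 * K)) sT.
rewrite (derive_add_in v (smooth_cst Uo (5 / 2)) sKT Uy).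
by rewrite derive_cst add0r (derive_scale_in Uo (2 * K) v sT Uy).
Qed.

Let Dr v y : U y -> 'D_v r y = - (a * (2 * K * 'D_v T y)).
Proof.
move=> Uy; have sac := smoothM Uo (smooth_cst Uo (- a)) sc.
have E : 'D_v r y = 'D_v (fun z => - a * c z + - n%:R) y.
  by apply: (eq_on_derive Uo v _ Uy) => z _; rewrite /r mulNr.
rewrite E (derive_add_in v sac (smooth_cst Uo (- n%:R)) Uy) derive_cst addr0.
by rewrite (derive_scale_in Uo (- a) v sc Uy) (Dc v Uy) mulNr.
Qed.

(* The operator d_tau - Lap - 2 <grad f, grad .>, applied to local_harnack, is
   at most Lap f - W / 2 - 2 T tr (B^2), see harnack_algebra. *)
Lemma local_harnack_max x : U x -> 0 < T x -> 'D_tau T x = 1 -> 0 <= K -> f x <= a ->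
  - K * Nrm2 f x <= \sum_j \sum_k Grad f j x * Grad f k x * Ric j k x ->
  0 < local_harnack x -> (forall i, 'D_(e i) local_harnack x = 0) -> Lap local_harnack x <= 0 ->
  'D_tau local_harnack x <= 0.
Proof.
move=> Ux Tx DT K0 fa hRic H0 DH LH.
have c0 i y : U y -> 'D_(e i) c y = 0 by move=> Uy; rewrite (Dc _ Uy) (T0 i Uy) mulr0.
have r0 i y : U y -> 'D_(e i) r y = 0 by move=> Uy; rewrite (Dr _ Uy) (T0 i Uy) !mulr0 oppr0.
have sft := smooth_in_derive tau sf.
have sW := smooth_lnorm2 e Uo sG pG sf.
have sL : smooth_in U (Lap f).
  by apply: (smooth_ldiv e Uo sG pG) => i; exact: smooth_lgrad.
pose XD h := \sum_i Grad f i x * 'D_(e i) h x.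
pose Q := \sum_j \sum_k Grad f j x * Grad f k x * Ric j k x.
pose B2 := \sum_i \sum_j lcov e G (Grad f) i j x * lcov e G (Grad f) j i x.
have one0 i (y : V) : U y -> 'D_(e i) (fun=> 1 : R) y = 0 by rewrite derive_cst.
have zero0 i (y : V) : U y -> 'D_(e i) (fun=> 0 : R) y = 0 by rewrite derive_cst.
have eLg : Lap g x = Lap ('D_tau f) x + Lap (Nrm2 f) x.
  have E i y : U y -> Grad g i y = Grad (fun z => 1 * 'D_tau f z + (1 * Nrm2 f z + 0)) i y.
    by move=> Uy; apply: eq_bigr => j _; congr (_ * _); apply: (eq_on_derive Uo _ _ Uy) => z _;
      rewrite /g addr0 !mul1r.
  rewrite /llap (ldiv_eq_on e G Uo E Ux).
  have := llap_comb sW sft (smooth_cst Uo 1) (smooth_cst Uo 1) (smooth_cst Uo 0) one0 one0 zero0 Ux.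
  by rewrite !mul1r.
have eLH : Lap local_harnack x = T x * (Lap ('D_tau f) x + Lap (Nrm2 f) x) + c x * Lap f x.
  by rewrite -eLg; exact: (llap_comb sf sg sT sc sr T0 c0 r0 Ux).
have eDg : 'D_tau g x = 'D_tau ('D_tau f) x + 'D_tau (Nrm2 f) x.
  exact: (derive_add_in tau sft sW Ux).
have eDft : 'D_tau ('D_tau f) x = Lap ('D_tau f) x + 'D_tau (Nrm2 f) x.
  rewrite (eq_on_derive Uo tau heat Ux) (derive_add_in tau sL sW Ux).
  by rewrite (derive_tau_llap sf Ux).
have eDW : 'D_tau (Nrm2 f) x = 2 * XD ('D_tau f) by exact: derive_tau_lnorm2.
have eXft : XD ('D_tau f) = XD (Lap f) + XD (Nrm2 f).
  rewrite -big_split; apply: eq_bigr => i _ /=.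
  by rewrite (eq_on_derive Uo (e i) heat Ux) (derive_add_in (e i) sL sW Ux) mulrDr.
have eLW : Lap (Nrm2 f) x = 2 * (XD (Lap f) + Q + B2) by exact: (bochner e Uo sG pG sf Ux).
have eXH : T x * (XD ('D_tau f) + XD (Nrm2 f)) + c x * Nrm2 f x = 0.
  transitivity (\sum_i Grad f i x * 'D_(e i) local_harnack x); last first.
    by apply: big1 => i _; rewrite DH mulr0.
  rewrite -big_split !mulr_sumr -big_split; apply: eq_bigr => i _ /=.
  have := derive_space_comb sf sg sT sc sr T0 c0 r0 i Ux; rewrite /local_harnack => ->.
  rewrite (derive_add_in (e i) sft sW Ux).
  by move: (derive _ _ _) (derive _ _ _) (derive _ _ _) => u v w; ring.
have eDH : 'D_tau local_harnack x =
    T x * 'D_tau g x + g x + (c x * 'D_tau f x + f x * (2 * K) - a * (2 * K)).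
  have := derive_comb sf sg sT sc sr tau Ux; rewrite /local_harnack => ->.
  by rewrite (Dc _ Ux) (Dr _ Ux) DT !mulr1.
have W0 : 0 <= Nrm2 f x := lnorm2_ge0 f Ux.
have B20 : 0 <= B2 := hessian_norm2_ge0 sf Ux.
have LB2 : Lap f x ^+ 2 <= n%:R * B2 := sqr_llap_le e Uo sG pG sf Ux.
have eH : local_harnack x = T x * (Lap f x + Nrm2 f x + Nrm2 f x) + (c x * f x + r x).
  by rewrite -(heat Ux).
have eg : g x = Lap f x + Nrm2 f x + Nrm2 f x by rewrite -(heat Ux).
move: eDH LH H0; rewrite eLH eH eDg eDft eLW eDW eXft eg (heat Ux) => ->.
move: eXH; rewrite eXft {}/r {}/c.
move: hRic; rewrite -/Q.
clear -W0 B20 LB2 Tx K0 fa.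
move: (Lap f x) (Nrm2 f x) (XD (Lap f)) (XD (Nrm2 f)) (Lap ('D_tau f) x) (T x) (f x)
  W0 B20 LB2 Tx fa.
(* What remains is real arithmetic: [XL] and [XW] are the derivatives of [L = Lap f] and
   [W = |grad f|^2] along [grad f], [Lt] is the Laplacian of [f_t], [q] is the Ricci term and [b] is
   [tr (B^2)]. *)
move=> L W XL XW Lt t y; move: Q B2 => q b W0 b0 Lb t0 ya Rq eX LH H0.
have nt : n%:R < t * (L + 2 * W).
  rewrite -subr_gt0; apply: lt_le_trans H0 _; rewrite -subr_ge0.
  set z := (X in 0 <= X); have -> : z = (5 / 2 + 2 * K * t) * (a - y) by rewrite /z; field.
  by rewrite mulr_ge0 ?subr_ge0 // addr_ge0 ?divr_ge0 // !mulr_ge0 // ltW.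
have ly := harnack_algebra W0 t0 b0 Lb nt.
have Ky : 0 <= K * (a - y) by rewrite mulr_ge0 ?subr_ge0.
have tq : 0 <= t * (q + K * W).
  by apply: mulr_ge0; [exact: ltW|move: Rq; rewrite mulNr; lra].
(* The time derivative is split into the Laplacian of the Harnack quantity, nonpositive by [LH],
   twice its derivative along [grad f], zero by [eX], and a remainder that is nonpositive by [ly],
   [tq] and [Ky]. *)
set z := (X in X <= 0).
have -> : z = (t * (Lt + 2 * (XL + q + b)) + (5 / 2 + 2 * K * t) * L)
   + 2 * (t * (XL + XW + XW) + (5 / 2 + 2 * K * t) * W)
   + ((L - 2^-1 * W - 2 * t * b) - 2 * (t * (q + K * W)) - 2 * (K * (a - y))).
  by rewrite /z; field.
rewrite eX mulr0 addr0; apply: (le_trans (lerD LH (lexx _))).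
by rewrite add0r; lra.
Qed.

End HarnackQuantity.
End Parabolic.

(** * The heat equation for the logarithm of a solution *)

Section Logarithm.
Variables (R : realType) (V : normedModType R) (n : nat) (e : 'I_n -> V) (tau : V).
Variables (G : V -> 'M[R]_n) (U : set V).
Hypothesis Uo : open U.
Hypothesis sG : forall i j, smooth_in U (fun x => G x i j).
Hypothesis pG : forall x, U x -> posdef (G x).
Variable u : V -> R.
Hypothesis su : smooth_in U u.
Hypothesis u0 : forall x, U x -> 0 < u x.

Let f x := ln (u x).

Lemma derive_ln_in v x : U x -> 'D_v f x = (u x)^-1 * 'D_v u x.
Proof.
by move=> Ux; have [_ ->] := derive_ln (u0 Ux) (smooth_in_derivable v su Ux); exact: mulrC.
Qed.

Let iu x := (u x)^-1.
Let siu : smooth_in U iu.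
Proof. by apply: (smoothV Uo) => // x /u0; rewrite lt0r => /andP[]. Qed.

Lemma lgrad_ln i x : U x -> lgrad e G f i x = iu x * lgrad e G u i x.
Proof.
move=> Ux; rewrite /lgrad mulr_sumr; apply: eq_bigr => j _.
by rewrite derive_ln_in // mulrCA.
Qed.

Lemma lnorm2_ln x : U x -> lnorm2 e G f x = iu x * iu x * lnorm2 e G u x.
Proof.
move=> Ux; rewrite /lnorm2 mulr_sumr; apply: eq_bigr => i _.
by rewrite lgrad_ln // derive_ln_in // /iu; ring.
Qed.

Lemma llap_ln x : U x -> llap e G f x = iu x * llap e G u x - iu x * iu x * lnorm2 e G u x.
Proof.
move=> Ux; have sX i := smooth_lgrad e Uo sG pG i su.
rewrite /llap (ldiv_eq_on e G Uo lgrad_ln Ux) /ldiv mulr_sumr /lnorm2 mulr_sumr -sumrB.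
apply: eq_bigr => i _; rewrite (derive_mul_in (e i) siu (sX i) Ux).
have -> : 'D_(e i) iu x = - (iu x * iu x) * 'D_(e i) u x.
  have uN0 : u x != 0 by rewrite gt_eqF // u0.
  by rewrite [LHS](deriveV uN0 (smooth_in_derivable _ su Ux)) /iu -invfM -expr2.
rewrite mulrDr mulr_sumr.
have -> : \sum_j lchr e G i i j x * (iu x * lgrad e G u j x) =
   \sum_j iu x * (lchr e G i i j x * lgrad e G u j x).
  by apply: eq_bigr => j _; rewrite mulrCA.
by move: (derive _ _ _) (derive _ _ _) => a b; ring.
Qed.

Lemma heat_ln x : (forall y, U y -> 'D_tau u y = llap e G u y) -> U x ->
  'D_tau f x = llap e G f x + lnorm2 e G f x.
Proof.
move=> heat Ux; rewrite derive_ln_in // heat // llap_ln // lnorm2_ln //.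
by rewrite subrK.
Qed.

End Logarithm.

(** * The Laplacian at a spatial maximum *)

Section SpatialMaximum.
Variables (R : realType) (n : nat) (G : 'rV[R]_n -> 'M[R]_n) (U : set 'rV[R]_n).
Hypothesis Uo : open U.
Hypothesis sG : forall i j, smooth_in U (fun x => G x i j).
Hypothesis pG : forall x, U x -> posdef (G x).
Local Notation e := (fun i : 'I_n => (delta_mx 0 i : 'rV[R]_n)).

Lemma derive_lin (F : 'rV[R]_n -> R) v x : smooth_in U F -> U x ->
  'D_v F x = \sum_k v 0 k * 'D_(e k) F x.
Proof.
by move=> sF Ux; have [dF eF] := C1_differentiable Uo Ux sF; rewrite (deriveE _ dF) eF.
Qed.

Lemma llap_max_le0 (F : 'rV[R]_n -> R) x : smooth_in U F -> U x ->
  (\forall y \near x, F y <= F x) ->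
  (forall i, 'D_(e i) F x = 0) /\ llap e G F x <= 0.
Proof.
move=> sF Ux Fx.
have D0 i : 'D_(e i) F x = 0 by have [] := second_derive_le0 (e i) Uo sF Ux Fx.
split=> //.
have g0 i : lgrad e G F i x = 0 by apply: big1 => j _; rewrite D0 mulr0.
have sI i j := smooth_invG Uo sG pG i j.
(* At a critical point the first-order terms drop out, those with Christoffel symbols included, and
   the Laplacian is the metric trace of the matrix of second partial derivatives. *)
have -> : llap e G F x = \sum_i \sum_j invmx (G x) i j * 'D_(e i) ('D_(e j) F) x.
  apply: eq_bigr => i _; rewrite [X in _ + X]big1 ?addr0; last by move=> j _; rewrite g0 mulr0.
  have sT j := smoothM Uo (sI i j) (smooth_in_derive (e j) sF).
  rewrite (derive_sum_in Uo (e i) sT Ux); apply: eq_bigr => j _.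
  by rewrite (derive_mul_in (e i) (sI i j) (smooth_in_derive (e j) sF) Ux) D0 mul0r addr0.
have := trace_invmx_le0 (pG Ux) (F := \matrix_(i, j) 'D_(e i) ('D_(e j) F) x).
under eq_bigr => i _ do under eq_bigr => j _ do rewrite mxE.
apply=> v.
have [_] := second_derive_le0 v Uo sF Ux Fx.
(* Expanding ['D_v] twice in coordinates turns the second derivative along [v] into the quadratic
   form of the second partial derivatives. *)
rewrite (eq_on_derive Uo v (fun y => @derive_lin F v y sF) Ux).
have sT k : smooth_in U (fun y => v 0 k * 'D_(e k) F y).
  exact: (smoothM Uo (smooth_cst Uo _) (smooth_in_derive _ sF)).
rewrite (derive_sum_in Uo v sT Ux) exchange_big => h; apply: le_trans h.
rewrite le_eqVlt; apply/orP; left; apply/eqP; apply: eq_bigr => j _.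
rewrite (derive_scale_in Uo _ v (smooth_in_derive (e j) sF) Ux).
rewrite (derive_lin v (smooth_in_derive (e j) sF) Ux) mulr_sumr; apply: eq_bigr => i _.
by rewrite mxE mulrA [v 0 j * _]mulrC.
Qed.

End SpatialMaximum.

(** * Composition of smooth maps *)

Section SmoothComposition.
Variables (R : realType) (V : normedModType R) (n : nat).

Lemma smooth_coord (U : set V) (phi : V -> 'rV[R]_n) k : open U -> smooth_in U phi ->
  smooth_in U (fun z => phi z 0 k).
Proof.
move=> Uo sphi.
have E s z : U z -> iter_derive s (fun z => phi z 0 k) z = iter_derive s phi z 0 k.
  elim: s z => //= v s IH z Uz.
  rewrite (eq_on_derive Uo v IH Uz).
  have [_ /(_ v) d] := sphi s z Uz.
  by rewrite derive_mx // mxE.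
move=> s z Uz; have [cs ds] := sphi s z Uz.
have nE : \near z, iter_derive s phi z 0 k = iter_derive s (fun z => phi z 0 k) z.
  by near=> w; apply/esym/E; near: w; exact: open_nbhs_nbhs.
split=> [|v].
  rewrite /prop_for /continuous_at E //.
  apply: (cvg_trans (near_eq_cvg nE)).
  exact: (continuous_comp cs (@coord_continuous _ _ _ 0 k _)).
apply: (near_eq_derivable nE).
by have /derivable_mxP := ds v; apply.
Unshelve. all: by end_near. Qed.

Variables (U : set V) (W : set 'rV[R]_n) (phi : V -> 'rV[R]_n).
Hypotheses (Uo : open U) (Wo : open W).
Hypothesis cphi : forall z, U z -> {for z, continuous phi}.
Hypothesis sphi : forall k, smooth_in U (fun z => phi z 0 k).
Hypothesis phiW : forall z, U z -> W (phi z).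

Lemma derive_comp_in (F : 'rV[R]_n -> R) v z : smooth_in W F -> U z ->
  'D_v (fun z => F (phi z)) z =
  \sum_k 'D_v (fun z => phi z 0 k) z * 'D_(delta_mx 0 k) F (phi z).
Proof.
move=> sF Uz; apply: (derive_chain Wo (phiW Uz) sF) => k.
exact: smooth_in_derivable v (sphi k) Uz.
Qed.

Lemma smooth_comp (F : 'rV[R]_n -> R) : smooth_in W F -> smooth_in U (fun z => F (phi z)).
Proof.
move=> sF; apply/smooth_inP => k; elim: k F sF => [|k IH] F sF.
  move=> z Uz; apply: (@continuous_comp _ _ _ phi F); first exact: cphi.
  exact: smooth_in_continuous sF (phiW Uz).
split=> [z Uz|z v Uz|v].
- apply: (@continuous_comp _ _ _ phi F); first exact: cphi.
  exact: smooth_in_continuous sF (phiW Uz).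
- exact: (derivable_chain Wo (phiW Uz) sF (fun k => smooth_in_derivable v (sphi k) Uz)).
- have sT j : Ck k U (fun z => 'D_v (fun z => phi z 0 j) z * 'D_(delta_mx 0 j) F (phi z)).
    apply: (CkM Uo); first exact: (smooth_inP _ _).1 (smooth_in_derive v (sphi j)) k.
    exact: IH (smooth_in_derive _ sF).
  apply: (eq_on_Ck Uo _ (Ck_sum Uo (index_enum 'I_n) xpredT sT)) => z Uz.
  by rewrite (derive_comp_in v sF Uz).
Qed.

End SmoothComposition.

(** * Change of coordinates *)

Section ContractedChristoffel.
Variables (R : realType) (V : normedModType R) (n : nat) (e : 'I_n -> V).
Variables (G : V -> 'M[R]_n) (U : set V).
Hypothesis Uo : open U.
Hypothesis pG : forall x, U x -> posdef (G x).

Definition dmetric j x : 'M[R]_n := \matrix_(a, b) 'D_(e j) (fun y => G y a b) x.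

(** This contraction is the logarithmic derivative of [sqrt (det g)]: the two other terms in the
    definition of the symbols cancel by symmetry. It is all that the divergence sees of the
    Christoffel symbols. *)
Lemma sum_lchr j x : U x -> \sum_i lchr e G i i j x = 2^-1 * \tr (invmx (G x) *m dmetric j x).
Proof.
move=> Ux; rewrite /lchr -mulr_sumr; congr (_ * _).
pose S := \sum_i \sum_l invmx (G x) i l * 'D_(e i) (fun y => G y j l) x.
have S' : S = \sum_i \sum_l invmx (G x) i l * 'D_(e l) (fun y => G y i j) x.
  rewrite /S sum2C; apply: eq_sum2 => i l.
  by rewrite (invG_sym pG l i Ux) (derive_G_sym e Uo pG j i l Ux).
transitivity (S + \tr (invmx (G x) *m dmetric j x) - S); last by rewrite addrAC subrr add0r.
rewrite {2}S' /S /mxtrace -big_split -sumrB; apply: eq_bigr => i _ /=.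
rewrite mxE -big_split -sumrB; apply: eq_bigr => l _ /=.
rewrite mxE (derive_G_sym e Uo pG l i j Ux).
by rewrite mulrBr mulrDr.
Qed.

Lemma ldiv_trace X x : U x -> ldiv e G X x =
  \sum_i 'D_(e i) (X i) x + \sum_j 2^-1 * \tr (invmx (G x) *m dmetric j x) * X j x.
Proof.
move=> Ux; rewrite /ldiv big_split /=; congr (_ + _); rewrite exchange_big.
by apply: eq_bigr => j _ /=; rewrite -mulr_suml sum_lchr.
Qed.

End ContractedChristoffel.

Section ChangeOfCoordinates.
Variables (R : realType) (n : nat) (U W : set 'rV[R]_n) (phi : 'rV[R]_n -> 'rV[R]_n).
Hypotheses (Uo : open U) (Wo : open W).
Hypothesis cphi : forall z, U z -> {for z, continuous phi}.
Hypothesis sphi : forall k, smooth_in U (fun z => phi z 0 k).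
Hypothesis phiW : forall z, U z -> W (phi z).
Variables (G G' : 'rV[R]_n -> 'M[R]_n).
Hypothesis pG : forall z, U z -> posdef (G z).
Hypothesis sG' : forall i j, smooth_in W (fun z => G' z i j).
Hypothesis pG' : forall z, W z -> posdef (G' z).
Local Notation e := (fun i : 'I_n => (delta_mx 0 i : 'rV[R]_n)).
(** Rows are indexed by the source coordinates, so that [G = J G' J^T] and the components of vector
    fields are transported by [J^T]. *)
Let J i k z := 'D_(e i) (fun z => phi z 0 k) z.
Hypothesis G_change : forall z i j, U z ->
  G z i j = \sum_k \sum_l J i k z * J j l z * G' (phi z) k l.

Let Jm z : 'M[R]_n := \matrix_(i, k) J i k z.
Let sJ i k : smooth_in U (J i k) := smooth_in_derive (e i) (sphi k).

Lemma metric_congr z : U z -> G z = Jm z *m G' (phi z) *m (Jm z)^T.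
Proof.
move=> Uz; apply/matrixP => i j; rewrite G_change // mxE exchange_big.
apply: eq_bigr => l _ /=; rewrite !mxE mulr_suml; apply: eq_bigr => k _.
by rewrite !mxE; ring.
Qed.

Lemma Jm_unit z : U z -> Jm z \in unitmx.
Proof.
move=> Uz; have := posdef_unitmx (pG Uz); rewrite metric_congr // !unitmx_mul.
by case/andP => /andP[].
Qed.

Lemma invmx_metric_congr z : U z ->
  invmx (G z) = (invmx (Jm z))^T *m invmx (G' (phi z)) *m invmx (Jm z).
Proof.
move=> Uz; have uJ := Jm_unit Uz; have uG' := posdef_unitmx (pG' (phiW Uz)).
have E : G z *m ((invmx (Jm z))^T *m invmx (G' (phi z)) *m invmx (Jm z)) = 1%:M.
  rewrite metric_congr // !mulmxA -(mulmxA _ (Jm z)^T) -trmx_mul mulVmx // trmx1 mulmx1.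
  by rewrite mulmxK // mulmxV.
by rewrite -[LHS]mulmx1 -E mulKmx // posdef_unitmx //; exact: pG.
Qed.

Let dJ j z : 'M[R]_n := \matrix_(i, k) 'D_(e j) (J i k) z.

Lemma dmetric_change j z : U z -> dmetric e G j z =
  dJ j z *m G' (phi z) *m (Jm z)^T + Jm z *m G' (phi z) *m (dJ j z)^T
  + Jm z *m (\sum_m J j m z *: dmetric e G' m (phi z)) *m (Jm z)^T.
Proof.
move=> Uz; apply/matrixP => a b.
have sGp k l : smooth_in U (fun z => G' (phi z) k l).
  exact: (smooth_comp Uo Wo cphi sphi phiW (sG' k l)).
have sJJ k l := smoothM Uo (sJ a k) (sJ b l).
have sT k l := smoothM Uo (sJJ k l) (sGp k l).
have sTs k := smooth_sum Uo (index_enum 'I_n) xpredT (sT k).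
rewrite [LHS]mxE (eq_on_derive Uo (e j) (fun y => @G_change y a b) Uz).
rewrite (derive_sum_in Uo (e j) sTs Uz).
under eq_bigr => k _ do rewrite (derive_sum_in Uo (e j) (sT k) Uz).
transitivity (\sum_k \sum_l ('D_(e j) (J a k) z * J b l z * G' (phi z) k l
  + J a k z * 'D_(e j) (J b l) z * G' (phi z) k l
  + J a k z * J b l z * \sum_m J j m z * 'D_(e m) (fun y => G' y k l) (phi z))).
  apply: eq_sum2 => k l.
  rewrite (derive_mul_in (e j) (sJJ k l) (sGp k l) Uz).
  rewrite (derive_mul_in (e j) (sJ a k) (sJ b l) Uz).
  rewrite (derive_comp_in Wo sphi phiW (e j) (sG' k l) Uz).
  by move: (derive _ _ _) (derive _ _ _) (\sum_m _) => p q r; ring.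
rewrite !sum2D !mxE; congr (_ + _ + _); rewrite sum2C; apply: eq_bigr => l _;
  rewrite !mxE mulr_suml; apply: eq_bigr => k _; rewrite !mxE; try ring.
rewrite summxE; under [in RHS]eq_bigr => m _ do rewrite !mxE.
by ring.
Qed.

(** The derivative of [J] enters twice, through [J] and through its transpose, each time with the
    trace [tr (J^-1 dJ)]; cyclicity of the trace removes the conjugations. *)
Lemma trace_dmetric_change j z : U z -> \tr (invmx (G z) *m dmetric e G j z) =
  2 * \tr (invmx (Jm z) *m dJ j z)
  + \sum_m J j m z * \tr (invmx (G' (phi z)) *m dmetric e G' m (phi z)).
Proof.
move=> Uz; rewrite dmetric_change // invmx_metric_congr // !mulmxDr !linearD /=.
have uJ := Jm_unit Uz; have uG' := posdef_unitmx (pG' (phiW Uz)).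
have sG'z : (G' (phi z))^T = G' (phi z) by have [] := pG' (phiW Uz).
set K := invmx (Jm z); set H := invmx (G' (phi z)).
have KJ : K *m Jm z = 1%:M by rewrite mulVmx.
have JK : (Jm z)^T *m K^T = 1%:M by rewrite -trmx_mul KJ trmx1.
have e1 : \tr (K^T *m H *m K *m (dJ j z *m G' (phi z) *m (Jm z)^T)) = \tr (K *m dJ j z).
  rewrite mxtrace_mulC !mulmxA -(mulmxA _ (Jm z)^T) JK mulmx1.
  by rewrite -(mulmxA (dJ j z)) mulmxV // mulmx1 mxtrace_mulC.
have e2 : \tr (K^T *m H *m K *m (Jm z *m G' (phi z) *m (dJ j z)^T)) = \tr (K *m dJ j z).
  rewrite !mulmxA -(mulmxA _ K) KJ mulmx1 -(mulmxA _ H) mulVmx // mulmx1.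
  by rewrite -trmx_mul mxtrace_tr mxtrace_mulC.
have e3 : \tr (K^T *m H *m K *m (Jm z *m (\sum_m J j m z *: dmetric e G' m (phi z)) *m (Jm z)^T))
   = \sum_m J j m z * \tr (H *m dmetric e G' m (phi z)).
  rewrite mxtrace_mulC !mulmxA -(mulmxA _ (Jm z)^T) JK mulmx1 mxtrace_mulC !mulmxA.
  rewrite KJ mul1mx mxtrace_mulC mulmx_sumr raddf_sum /=; apply: eq_bigr => m _.
  by rewrite -scalemxAr mxtraceZ.
by rewrite e1 e2 e3 mulr_natl mulr2n.
Qed.

(* Gamma^i_ij = tr (g^-1 d_j g) / 2 with g = J g' J^T: the derivatives of J in
   this trace cancel those in the derivatives of the components of X. *)
Lemma ldiv_change (X X' : 'I_n -> 'rV[R]_n -> R) z :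
  (forall i, smooth_in U (X i)) -> (forall k, smooth_in W (X' k)) ->
  (forall k y, U y -> X' k (phi y) = \sum_i J i k y * X i y) -> U z ->
  ldiv e G X z = ldiv e G' X' (phi z).
Proof.
move=> sX sX' XX' Uz; have uJ := Jm_unit Uz.
pose K := invmx (Jm z).
have Dik i k : \sum_m Jm z i m * 'D_(e m) (X' k) (phi z) =
    \sum_l (Jm z l k * 'D_(e i) (X l) z + X l z * 'D_(e i) (J l k) z).
  have sT l := smoothM Uo (sJ l k) (sX l).
  transitivity ('D_(e i) (fun y => X' k (phi y)) z).
    rewrite (derive_comp_in Wo sphi phiW (e i) (sX' k) Uz).
    by apply: eq_bigr => m _; rewrite mxE.
  rewrite (eq_on_derive Uo (e i) (XX' k) Uz) (derive_sum_in Uo (e i) sT Uz).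
  by apply: eq_bigr => l _; rewrite (derive_mul_in (e i) (sJ l k) (sX l) Uz) mxE.
(* Contracting [Dik] with the inverse Jacobian isolates the partial derivatives of [X']; the
   symmetry of the second derivatives of [phi] turns the extra term into the trace that also occurs
   in [trace_dmetric_change]. *)
have Dk : \sum_k 'D_(e k) (X' k) (phi z) =
    \sum_i 'D_(e i) (X i) z + \sum_l X l z * \tr (K *m dJ l z).
  transitivity (\sum_k \sum_i K k i * \sum_m Jm z i m * 'D_(e m) (X' k) (phi z)).
    apply: eq_bigr => k _.
    by rewrite (sum_mulVmx (fun m => 'D_(e m) (X' k) (phi z)) uJ).
  under eq_bigr => k _ do under eq_bigr => i _ do rewrite Dik mulr_sumr.
  transitivity (\sum_k \sum_i \sum_l K k i * (Jm z l k * 'D_(e i) (X l) z) +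
      \sum_k \sum_i \sum_l K k i * (X l z * 'D_(e i) (J l k) z)).
    by rewrite -sum3D; apply: eq_sum3 => k i l; rewrite mulrDr.
  congr (_ + _).
    rewrite sum3C23 sum3C12; apply: eq_bigr => l _.
    rewrite -(sum_mulmxV (fun i => 'D_(e i) (X l) z) uJ l).
    apply: eq_bigr => k _; rewrite mulr_sumr; apply: eq_bigr => i _.
    by rewrite mulrCA.
  rewrite sum3C23 sum3C12; apply: eq_bigr => l _; rewrite /mxtrace mulr_sumr.
  apply: eq_bigr => k _; rewrite mxE mulr_sumr; apply: eq_bigr => i _.
  by rewrite mulrCA mxE /J (derive_comm (e l) (e i) Uo (sphi k) Uz).
rewrite (ldiv_trace e Uo pG X Uz) (ldiv_trace e Wo pG' X' (phiW Uz)) Dk -addrA.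
congr (_ + _).
have -> : \sum_j 2^-1 * \tr (invmx (G' (phi z)) *m dmetric e G' j (phi z)) * X' j (phi z)
   = \sum_i X i z * (2^-1 * \sum_m J i m z * \tr (invmx (G' (phi z)) *m dmetric e G' m (phi z))).
  under eq_bigr => j _ do rewrite (XX' j _ Uz) mulr_sumr.
  rewrite exchange_big; apply: eq_bigr => i _ /=; rewrite !mulr_sumr.
  by apply: eq_bigr => m _; ring.
rewrite -big_split; apply: eq_bigr => i _ /=.
rewrite trace_dmetric_change // -/K.
by move: (\tr _) (\sum_m _) => p q; field.
Qed.

Section Functions.
Variables (f f' : 'rV[R]_n -> R).
Hypothesis sG : forall i j, smooth_in U (fun z => G z i j).
Hypothesis sf' : smooth_in W f'.
Hypothesis ff' : forall z, U z -> f z = f' (phi z).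

Let sf : smooth_in U f.
Proof.
by apply: (eq_on_smooth Uo _ (smooth_comp Uo Wo cphi sphi phiW sf')) => z /ff'.
Qed.

Lemma derive_change i z : U z ->
  'D_(e i) f z = \sum_k J i k z * 'D_(e k) f' (phi z).
Proof.
move=> Uz; rewrite (eq_on_derive Uo (e i) ff' Uz).
exact: (derive_comp_in Wo sphi phiW (e i) sf' Uz).
Qed.

Lemma lgrad_change k z : U z ->
  lgrad e G' f' k (phi z) = \sum_i J i k z * lgrad e G f i z.
Proof.
move=> Uz; have uJ := Jm_unit Uz.
pose v := \col_k 'D_(e k) f' (phi z).
have E : (Jm z)^T *m (invmx (G z) *m (Jm z *m v)) = invmx (G' (phi z)) *m v.
  rewrite invmx_metric_congr // !mulmxA -trmx_mul mulVmx // trmx1 mul1mx.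
  by rewrite -(mulmxA _ _ (Jm z)) mulVmx // mulmx1.
transitivity ((invmx (G' (phi z)) *m v) k 0).
  by rewrite mxE; apply: eq_bigr => j _; rewrite mxE.
rewrite -E mxE; apply: eq_bigr => i _; rewrite !mxE; congr (_ * _).
apply: eq_bigr => j _; rewrite derive_change // !mxE; congr (_ * _).
by apply: eq_bigr => m _; rewrite !mxE.
Qed.

Lemma lnorm2_change z : U z -> lnorm2 e G f z = lnorm2 e G' f' (phi z).
Proof.
move=> Uz; rewrite /lnorm2.
under eq_bigr => i _ do rewrite derive_change // mulr_suml.
rewrite exchange_big; apply: eq_bigr => k _ /=; rewrite lgrad_change // mulr_sumr.
by apply: eq_bigr => i _; ring.
Qed.

Lemma llap_change z : U z -> llap e G f z = llap e G' f' (phi z).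
Proof.
move=> Uz.
have sX i := smooth_lgrad e Uo sG pG i sf.
have sX' i := smooth_lgrad e Wo sG' pG' i sf'.
exact: (ldiv_change sX sX' (fun k y => @lgrad_change k y) Uz).
Qed.

End Functions.
End ChangeOfCoordinates.

(** * Geometric quantities read in charts and on overlaps *)

Section Charts.
Variables (R : realType) (n : nat) (M : manifold R n).
Implicit Types (c : chart R n M) (p : M) (z : 'rV[R]_n).
Local Notation e := (fun i : 'I_n => (delta_mx 0 i : 'rV[R]_n)).

Lemma chart_invP c z : chart_img c z ->
  chart_dom c (chart_inv c z) /\ chart_map c (chart_inv c z) = z.
Proof. by move=> [p dp <-]; rewrite chart_mapK. Qed.

Lemma chart_img_map c p : chart_dom c p -> chart_img c (chart_map c p).
Proof. by move=> dp; exists p. Qed.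

Lemma chart_at_atlas p : atlas (chart_at p).
Proof. by rewrite /chart_at; case: cid => c []. Qed.

Lemma chart_at_dom p : chart_dom (chart_at p) p.
Proof. by rewrite /chart_at; case: cid => c []. Qed.

Definition overlap c c' := chart_map c @` (chart_dom c `&` chart_dom c').

Lemma overlapE c c' : overlap c c' = chart_img c `&` chart_inv c @^-1` (chart_dom c').
Proof.
rewrite eqEsubset; split=> z.
  by move=> [p [dp dp'] <-]; split; [exists p|rewrite /preimage /= chart_mapK].
move=> [cz dz]; have [d1 d2] := chart_invP cz.
by exists (chart_inv c z).
Qed.

Lemma overlap_open c c' : open (overlap c c').
Proof.
rewrite overlapE; move: (chart_dom c') (chart_dom_open c').
by apply/continuous_inP; [exact: chart_img_open|rewrite -continuous_open_subspace;
  [exact: chart_inv_continuous|exact: chart_img_open]].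
Qed.

Variable g : riemannian_metric M.

Definition pull_metric c z : 'M[R]_n := g c (chart_inv c z).

Lemma smooth_pull_metric c i j : atlas c ->
  smooth_in (chart_img c) (fun z => pull_metric c z i j).
Proof. by move=> ac; exact: metric_smooth. Qed.

Lemma posdef_pull_metric c z : atlas c -> chart_img c z -> posdef (pull_metric c z).
Proof.
move=> ac /chart_invP[dz _]; split; first exact: (Defs.metric_sym g ac dz).
exact: (metric_posdef g ac dz).
Qed.

Section InChart.
Variable c : chart R n M.
Local Notation O := (chart_img c).
Let Oo : open O := @chart_img_open _ _ _ c.
Local Notation G := (pull_metric c).

Lemma partial_inv i (f : M -> R) z : O z ->
  partial c i f (chart_inv c z) = 'D_(e i) (f \o chart_inv c) z.
Proof. by move=> /chart_invP[_ ez]; rewrite /partial ez. Qed.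

Lemma christoffel_inv k i j z : O z -> christoffel g c k i j (chart_inv c z) = lchr e G k i j z.
Proof.
by move=> Oz; rewrite /christoffel; under eq_bigr => l _ do rewrite !(partial_inv _ _ Oz).
Qed.

Lemma partial_christoffel_inv l k i j z : O z ->
  partial c l (christoffel g c k i j) (chart_inv c z) = 'D_(e l) (lchr e G k i j) z.
Proof.
move=> Oz; rewrite (partial_inv _ _ Oz).
exact: (eq_on_derive Oo (e l) (fun y => @christoffel_inv k i j y) Oz).
Qed.

Lemma ricci_inv j k z : O z -> ricci g c (chart_inv c z) j k = lric e G j k z.
Proof.
move=> Oz; rewrite mxE; apply: eq_bigr => i _; rewrite /riemann.
rewrite (partial_christoffel_inv _ _ _ _ Oz) (partial_christoffel_inv _ _ _ _ Oz).
by under [X in _ + X]eq_bigr => m _ do rewrite !(christoffel_inv _ _ _ Oz).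
Qed.

Lemma gradient_inv (f : M -> R) i z : O z ->
  gradient g c f i (chart_inv c z) = lgrad e G (f \o chart_inv c) i z.
Proof. by move=> Oz; apply: eq_bigr => j _; rewrite (partial_inv _ _ Oz). Qed.

Lemma divergence_gradient_inv (f : M -> R) z : O z ->
  divergence g c (gradient g c f) (chart_inv c z) = llap e G (f \o chart_inv c) z.
Proof.
move=> Oz; apply: eq_bigr => i _; rewrite (partial_inv _ _ Oz).
under eq_bigr => j _ do rewrite (christoffel_inv _ _ _ Oz) (gradient_inv f j Oz).
by rewrite (eq_on_derive Oo (e i) (fun y => @gradient_inv f i y) Oz).
Qed.

End InChart.

Section Overlap.
Variables (c c' : chart R n M) (p : M) (f : M -> R).
Hypotheses (ac : atlas c) (ac' : atlas c') (dp : chart_dom c p) (dp' : chart_dom c' p).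
Hypothesis sf : smooth_in (chart_img c') (f \o chart_inv c').

Let U := overlap c c'.
Let phi := chart_map c' \o chart_inv c.
Let Uo : open U := @overlap_open c c'.
Let Wo : open (chart_img c') := @chart_img_open _ _ _ c'.
Let sphiv : smooth_in U phi := atlas_smooth ac ac'.
Let cphi z : U z -> {for z, continuous phi}.
Proof. by move=> /(sphiv [::])[]. Qed.
Let sphi k : smooth_in U (fun z => phi z 0 k) := smooth_coord k Uo sphiv.
Let UO z : U z -> [/\ chart_img c z, chart_dom c (chart_inv c z), chart_dom c' (chart_inv c z)
   & chart_map c (chart_inv c z) = z].
Proof. by rewrite /U overlapE => -[Oz dz]; have [] := chart_invP Oz. Qed.
Let phiW z : U z -> chart_img c' (phi z).
Proof. by move=> /UO[_ _ d' _]; exact: chart_img_map. Qed.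
Let pG z : U z -> posdef (pull_metric c z).
Proof. by move=> /UO[Oz _ _ _]; exact: posdef_pull_metric. Qed.
Let sG i j : smooth_in U (fun z => pull_metric c z i j).
Proof. by apply: smooth_in_sub (smooth_pull_metric i j ac) => z /UO[]. Qed.
Let G_change z i j : U z -> pull_metric c z i j = \sum_k \sum_l
  'D_(e i) (fun z => phi z 0 k) z * 'D_(e j) (fun z => phi z 0 l) z * pull_metric c' (phi z) k l.
Proof.
move=> Uz; have [Oz d d' ez] := UO Uz.
rewrite {1}/pull_metric (metric_change g ac ac' d d'); apply: eq_bigr => k _.
apply: eq_bigr => l _; rewrite !(partial_inv _ _ Oz) /pull_metric /phi /=.
by rewrite (chart_mapK d').
Qed.
Let ff' z : U z -> (f \o chart_inv c) z = (f \o chart_inv c') (phi z).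
Proof. by move=> /UO[_ _ d' _]; rewrite /phi /= chart_mapK. Qed.
Let Up : U (chart_map c p). Proof. by exists p. Qed.
Let phip : phi (chart_map c p) = chart_map c' p.
Proof. by rewrite /phi /= chart_mapK. Qed.

Lemma llap_overlap : llap e (pull_metric c) (f \o chart_inv c) (chart_map c p) =
  llap e (pull_metric c') (f \o chart_inv c') (chart_map c' p).
Proof.
rewrite -phip; exact: (llap_change Uo Wo cphi sphi phiW pG
  (fun i j => @smooth_pull_metric c' i j ac') (fun z => @posdef_pull_metric c' z ac')
  G_change sG sf ff' Up).
Qed.

Lemma lnorm2_overlap : lnorm2 e (pull_metric c) (f \o chart_inv c) (chart_map c p) =
  lnorm2 e (pull_metric c') (f \o chart_inv c') (chart_map c' p).
Proof.
rewrite -phip; exact: (lnorm2_change Uo Wo sphi phiW pG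
  (fun z => @posdef_pull_metric c' z ac')
  G_change sf ff' Up).
Qed.

End Overlap.

(** [laplacian] uses a chart that varies with the point in an uncontrolled way; only through this
    identification with one fixed chart can it be treated as a smooth function. *)
Lemma laplacian_inv (f : M -> R) c z : atlas c -> chart_img c z ->
  (forall c', atlas c' -> smooth_in (chart_img c') (f \o chart_inv c')) ->
  laplacian g f (chart_inv c z) = llap e (pull_metric c) (f \o chart_inv c) z.
Proof.
move=> ac Oz sf; have [dz ez] := chart_invP Oz.
set p := chart_inv c z; have da := chart_at_dom p; have aa := chart_at_atlas p.
have := divergence_gradient_inv f (chart_img_map da); rewrite (chart_mapK da) => E.
rewrite /laplacian E.
by rewrite (llap_overlap aa ac da dz (sf _ ac)) ez.
Qed.

(** Modelled on [laplacian], with one chart per point, so that the Harnack quantity is a function on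
    all of [M] and can be maximized globally. *)
Definition gradient_norm2 (f : M -> R) p : R :=
  lnorm2 e (pull_metric (chart_at p)) (f \o chart_inv (chart_at p)) (chart_map (chart_at p) p).

Lemma gradient_norm2_inv (f : M -> R) c z : atlas c -> chart_img c z ->
  (forall c', atlas c' -> smooth_in (chart_img c') (f \o chart_inv c')) ->
  gradient_norm2 f (chart_inv c z) = lnorm2 e (pull_metric c) (f \o chart_inv c) z.
Proof.
move=> ac Oz sf; have [dz ez] := chart_invP Oz.
set p := chart_inv c z; have da := chart_at_dom p; have aa := chart_at_atlas p.
by rewrite /gradient_norm2 (lnorm2_overlap aa ac da dz (sf _ ac)) ez.
Qed.

End Charts.

Lemma continuous_pair (T A B : topologicalType) (f : T -> A) (g : T -> B) x :
  {for x, continuous f} -> {for x, continuous g} -> {for x, continuous (fun y => (f y, g y))}.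
Proof.
by move=> cf cg; exact: (@cvg_pair _ _ _ (nbhs x) (nbhs (f x)) (nbhs (g x)) _ _ _ f g cf cg).
Qed.

Section LinearFunctions.
Variables (R : realType) (V : normedModType R).

Lemma is_derive_linear (f : V -> R) y v :
  (forall h v y, f (h *: v + y) = h * f v + f y) -> is_derive y v f (f v).
Proof.
move=> lf.
have d : is_derive (0 : R) (1 : R) (fun h => f (h *: v + y)) (f v).
  rewrite (_ : (fun h => _) = (fun h : R => h * f v + f y)); last by apply/funext => h; rewrite lf.
  have d1 := is_derive_id (0 : R) (1 : R).
  have d2 := is_deriveD (is_deriveM d1 (is_derive_cst (f v) (0 : R) (1 : R)))
     (is_derive_cst (f y) (0 : R) (1 : R)).
  apply: is_derive_eq d2 _.
  by rewrite scaler0 add0r addr0 /cst [_ *: _]mulr1.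
have [d1 d2] := d.
apply: DeriveDef; first exact: (derivable1P f y v).2.
rewrite -d2 /derive; set g1 := fun s => s^-1 *: _; set g2 := fun s => s^-1 *: _.
suff -> : g1 = g2 by [].
by rewrite funeqE /g1 /g2 => s /=; rewrite addr0 scale0r add0r [_%:A]mulr1.
Qed.

Lemma smooth_linear (U : set V) (f : V -> R) : open U -> continuous f ->
  (forall h v y, f (h *: v + y) = h * f v + f y) -> smooth_in U f.
Proof.
move=> Uo cf lf; apply/smooth_inP => -[|k]; first by move=> x _; exact: cf.
split=> [x _|x v _|v]; first exact: cf.
  by have [] := is_derive_linear x v lf.
apply: (eq_on_Ck Uo _ (Ck_cst Uo k (f v))) => y _.
by have [_ ->] := is_derive_linear y v lf.
Qed.

End LinearFunctions.

(** * Space-time as a product: slices and cylinders *)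

Section Slices.
Variables (R : realType) (V : normedModType R).
Local Notation VT := (V * R)%type.
Implicit Types (H : VT -> R) (t : R).

Lemma slice_line (s t : R) (v z : V) : s *: ((v, 0) : VT) + (z, t) = (s *: v + z, t).
Proof.
have -> : (s *: v + z, t) = (s *: v + z, s *: 0 + t) by rewrite scaler0 add0r.
by [].
Qed.

Lemma derive_slice H t v : (fun z => 'D_((v, 0) : VT) H (z, t)) = 'D_v (fun z => H (z, t)).
Proof.
apply/funext => z; rewrite /derive; set g1 := fun s => s^-1 *: _; set g2 := fun s => s^-1 *: _.
suff -> : g1 = g2 by [].
rewrite funeqE /g1 /g2 => s; congr (_ *: (_ - _)).
exact: (congr1 H (slice_line s t v z)).
Qed.

Lemma derive_sliceE H z t v : 'D_((v, 0) : VT) H (z, t) = 'D_v (fun z => H (z, t)) z.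
Proof. exact: (congr1 (@^~ z) (derive_slice H t v)). Qed.

Lemma smooth_slice (O : set VT) H t : smooth_in O H ->
  smooth_in [set z | O (z, t)] (fun z => H (z, t)).
Proof.
move=> sH s z Oz.
have E : iter_derive s (fun z => H (z, t)) =
    (fun z => iter_derive [seq (v, 0) : VT | v <- s] H (z, t)).
  by elim: s => //= v s ->; exact: esym (derive_slice _ _ _).
have [cH dH] := sH [seq (v, 0) : VT | v <- s] (z, t) Oz.
rewrite E; split.
  apply: (@continuous_comp _ _ _ (fun z => (z, t) : VT)) cH.
  by apply: continuous_pair; [exact: cvg_id|exact: cvg_cst].
move=> v; have := dH (v, 0); rewrite /derivable.
set g1 := fun h => h^-1 *: _; set g2 := fun h => h^-1 *: _.
suff -> : g1 = g2 by [].
rewrite funeqE /g1 /g2 => h; congr (_ *: (_ - _)).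
exact: (congr1 (iter_derive _ H) (slice_line h t v z)).
Qed.

End Slices.

Section SpaceTime.
Variables (R : realType) (n : nat) (Gs : 'rV[R]_n -> 'M[R]_n).
Local Notation V := ('rV[R]_n)%type.
Local Notation VT := ('rV[R]_n * R)%type.
Local Notation e := (fun i : 'I_n => (delta_mx 0 i : 'rV[R]_n)).
Definition frame (i : 'I_n) : VT := (delta_mx 0 i, 0).
Definition time_dir : VT := (0, 1).
Definition st_metric (y : VT) := Gs y.1.
Implicit Types (H : VT -> R) (t : R) (z : V).

Lemma lchr_st k i j z t : lchr frame st_metric k i j (z, t) = lchr e Gs k i j z.
Proof.
rewrite /lchr; congr (_ * _); apply: eq_bigr => l _; congr (_ * _).
Qed.

Lemma lgrad_st H i z t : lgrad frame st_metric H i (z, t) = lgrad e Gs (fun z => H (z, t)) i z.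
Proof. by apply: eq_bigr => j _; rewrite derive_sliceE. Qed.

Lemma llap_st H z t : llap frame st_metric H (z, t) = llap e Gs (fun z => H (z, t)) z.
Proof.
apply: eq_bigr => i _; rewrite derive_sliceE.
have -> : (fun y => lgrad frame st_metric H i (y, t)) = lgrad e Gs (fun y => H (y, t)) i.
  by apply/funext => y; rewrite lgrad_st.
by under eq_bigr => j _ do rewrite lchr_st lgrad_st.
Qed.

Lemma lnorm2_st H z t : lnorm2 frame st_metric H (z, t) = lnorm2 e Gs (fun z => H (z, t)) z.
Proof. by apply: eq_bigr => i _; rewrite derive_sliceE lgrad_st. Qed.

Lemma lric_st j k z t : lric frame st_metric j k (z, t) = lric e Gs j k z.
Proof.
have E l a b c : 'D_(frame l) (lchr frame st_metric a b c) (z, t) = 'D_(e l) (lchr e Gs a b c) z.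
  rewrite derive_sliceE.
  have -> // : (fun y => lchr frame st_metric a b c (y, t)) = lchr e Gs a b c.
  by apply/funext => y; rewrite lchr_st.
apply: eq_bigr => i _; rewrite !E.
by under eq_bigr => m _ do rewrite !lchr_st.
Qed.

Lemma tau_invariant_st : tau_invariant time_dir st_metric.
Proof.
by move=> s [z t]; rewrite /st_metric -[_ + _]/(s *: 0 + z, s *: 1 + t) /= scaler0 add0r.
Qed.

Variable O : set V.
Hypothesis Oo : open O.
(** The strict inequality makes it open, as the calculus requires; starting at 0, it leaves out the
    initial time, where only one-sided derivatives exist. *)
Definition cylinder (s : R) : set VT := [set y | O y.1 /\ s < y.2].

Lemma open_cylinder s : open (cylinder s).
Proof.
have -> : cylinder s = (fst @^-1` O) `&` (snd @^-1` [set t | s < t]) by [].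
apply: openI; apply: open_comp => //.
- by move=> y _; exact: cvg_fst.
- by move=> y _; exact: cvg_snd.
Qed.

Lemma smooth_st_fst (h : V -> R) s : smooth_in O h -> smooth_in (cylinder s) (fun y => h y.1).
Proof.
have co := @open_cylinder s.
apply: (smooth_comp co Oo) => [y _|k|y []//].
  exact: cvg_fst.
apply: (smooth_linear co); last by move=> a v y; rewrite !mxE.
move=> y; apply: (@continuous_comp _ _ _ fst (fun z : V => z 0 k)); first exact: cvg_fst.
exact: coord_continuous.
Qed.

Lemma is_derive_time (s : R) (y v : VT) : is_derive y v (fun y : VT => y.2 - s) v.2.
Proof.
have d : is_derive y v (fun y : VT => y.2) v.2 by apply: is_derive_linear => a [? ?] [? ?].
have := is_deriveB d (is_derive_cst s y v); rewrite subr0; exact.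
Qed.

Lemma smooth_time (a s : R) : smooth_in (cylinder a) (fun y : VT => y.2 - s).
Proof.
have co := @open_cylinder a; apply: (smoothB co _ (smooth_cst co s)).
by apply: (smooth_linear co) => [y|h [? ?] [? ?]//]; exact: cvg_snd.
Qed.

End SpaceTime.

(** * The maximum principle *)

Section TimeDerivative.
Variable R : realType.

Lemma is_time_derive_unique (f : R -> R) (t l : R) : 0 < t -> derivable f t 1 ->
  is_time_derive f t l -> 'D_1 f t = l.
Proof.
move=> t0 df fl.
have c1 : (s - t)^-1 * (f s - f t) @[s --> t^'] --> l.
  move=> B /fl; rewrite /= /within /= => nB.
  (* A positive time is interior to the half-line, so the one-sided constraint is void near [t]. *)
  have nA : \forall s \near t^', 0 <= s.
    apply: cvg_within; near=> s; apply: ltW; near: s.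
    exact: lt_nbhsr.
  by apply: filterS2 nA nB => s s0 h; exact: h s0.
have c2 : (s - t)^-1 * (f s - f t) @[s --> t^'] --> 'D_1 f t.
  apply/cvgrPdist_lt => eps eps0.
  have /cvgrPdist_lt/(_ _ eps0) := df.
  case/nbhs_ballP => d d0 dP.
  apply/nbhs_ballP; exists d => // s sd st /=.
  have := dP (s - t); rewrite /ball /= sub0r normrN distrC => /(_ sd).
  rewrite subr_eq0 => /(_ st); rewrite [_ *: 1]mulr1 subrK; exact.
exact: (cvg_unique _ c2 c1).
Unshelve. all: by end_near. Qed.

(** Only earlier times are compared, since a maximum over a time interval may be attained at its
    end. The difference quotients from the left are then at least [eps]. *)
Lemma derive_ge_at_left_max (F : R -> R) (a t1 eps : R) : a < t1 -> derivable F t1 1 ->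
  (forall t, a < t <= t1 -> F t - eps * t <= F t1 - eps * t1) -> eps <= 'D_1 F t1.
Proof.
move=> at1 dF Fmax; rewrite leNgt; apply/negP => De.
have e0 : 0 < eps - 'D_1 F t1 by rewrite subr_gt0.
have /cvgrPdist_lt/(_ _ e0) := dF; case/nbhs_ballP => d d0 dP.
pose h := - (Num.min (d / 2) ((t1 - a) / 2)).
have h0 : h < 0 by rewrite oppr_lt0 lt_min !divr_gt0 // subr_gt0.
have hd : `|h| < d.
  rewrite ltr0_norm // opprK (@le_lt_trans _ _ (d / 2)) // ?ge_min ?lexx //.
  by rewrite ltr_pdivrMr // ltr_pMr // ltr1n.
have ha : a < h + t1.
  have : - h <= (t1 - a) / 2 by rewrite opprK ge_min lexx orbT.
  lra.
have q : `|'D_1 F t1 - h^-1 * (F (h + t1) - F t1)| < eps - 'D_1 F t1.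
  have := dP h; rewrite /ball /= sub0r normrN => /(_ hd (ltr0_neq0 h0)).
  by rewrite [_ *: 1]mulr1; exact.
have := Fmax (h + t1); rewrite ha /= gerDr (ltW h0) => /(_ isT) Fh.
have : h^-1 * (F (h + t1) - F t1) < eps.
  move: q; move: ('D_1 F t1) (h^-1 * _) => A B.
  by rewrite ltr_norml => /andP[]; lra.
rewrite ltNge => /negP; apply.
by rewrite ler_ndivlMl //; lra.
Qed.

(* Subtracting eps * t before maximizing makes the time derivative of Phi
   positive at the maximum, and not just nonnegative. *)
Lemma compact_time_max (M : topologicalType) (Phi : R -> M -> R) (a b : R) :
  compact [set: M] ->
  {within `[a, b]%classic `*` [set: M], continuous (fun x : R * M => Phi x.1 x.2)} ->
  (forall p, Phi a p <= 0) -> forall t p, a <= t <= b -> 0 < Phi t p ->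
  exists eps t1 p1, [/\ 0 < eps, a < t1 <= b, 0 < Phi t1 p1 &
    forall s q, a <= s <= b -> Phi s q - eps * s <= Phi t1 p1 - eps * t1].
Proof.
move=> cM cPhi Phi0 t p tab Pt.
have at0 : a < t.
  rewrite lt_neqAle; case/andP: tab => -> _; rewrite andbT; apply/eqP => at_.
  by move: Pt; rewrite -at_ ltNge Phi0.
(* With this choice the penalty between [a] and [t] costs only half of [Phi t p]: [Phi] is still
   positive at the maximum, which is therefore not attained at time [a]. *)
pose eps := Phi t p / 2 / (t - a).
have eps0 : 0 < eps by rewrite !divr_gt0 // subr_gt0.
pose Psi (x : R * M) := Phi x.1 x.2 - eps * x.1.
have cPsi : {within `[a, b]%classic `*` [set: M], continuous Psi}.
  apply/subspace_continuousP => x Ax; apply: cvgB.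
    exact: (subspace_continuousP _ _).1 cPhi x Ax.
  apply: cvg_within_filter; apply: cvgM; [exact: cvg_cst|exact: cvg_fst].
have [||[t1 p1] m max1] := compact_EVT_max _ _ cPsi.
- by exists (t, p); split => //=; rewrite in_itv.
- by apply: compact_setX => //; exact: segment_compact.
have Psi1 s q : a <= s <= b -> Psi (s, q) <= Psi (t1, p1).
  by move=> sab; apply: max1; rewrite inE; split => //=; rewrite in_itv.
have [t1a t1b] : a <= t1 /\ t1 <= b.
  by move: m; rewrite inE => -[/=]; rewrite in_itv /= => /andP[].
have P1 : 0 < Phi t1 p1.
  have := Psi1 t p tab; rewrite /Psi /=.
  have e1 : eps * (t - a) = Phi t p / 2 by rewrite /eps divfK // subr_eq0 gt_eqF.
  have : 0 <= eps * (t1 - a) by rewrite mulr_ge0 ?subr_ge0 // ltW.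
  lra.
exists eps, t1, p1; split => //; rewrite t1b andbT lt_neqAle t1a andbT.
by apply/eqP => at1; move: P1; rewrite -at1 ltNge Phi0.
Qed.

Lemma derive_time_slice (V : normedModType R) (H : V * R -> R) z t :
  'D_((0, 1) : V * R) H (z, t) = 'D_1 (fun s => H (z, s)) t /\
  (derivable H (z, t) ((0, 1) : V * R) -> derivable (fun s => H (z, s)) t 1).
Proof.
have L s : s *: ((0, 1) : V * R) + (z, t) = (z, s *: 1 + t).
  have -> : (z, s *: 1 + t) = (s *: 0 + z, s *: 1 + t) by rewrite scaler0 add0r.
  by [].
rewrite /derivable /derive.
set g1 := fun h => h^-1 *: _; set g2 := fun h => h^-1 *: _.
suff -> : g1 = g2 by [].
rewrite funeqE /g1 /g2 => h; congr (_ *: (_ - _)).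
exact: (congr1 H (L h)).
Qed.

End TimeDerivative.

(** * Functions on space-time and the parabolic maximum principle *)

Section SpaceTimeFunctions.
Variables (R : realType) (n : nat) (M : manifold R n) (g : riemannian_metric M).
Implicit Types (c : chart R n M) (p : M) (Phi u : R -> M -> R).
Local Notation V := ('rV[R]_n)%type.
Local Notation VT := ('rV[R]_n * R)%type.
Local Notation e := (fun i : 'I_n => (delta_mx 0 i : 'rV[R]_n)).
Local Notation fr := (@frame R n).
Local Notation td := (@time_dir R n).

Definition pull c Phi (y : VT) := Phi y.2 (chart_inv c y.1).
Definition smooth_after (a : R) Phi := forall c, atlas c ->
  smooth_in (cylinder (chart_img c) a) (pull c Phi).
Local Notation Gst c := (st_metric (pull_metric g c)).

Lemma smooth_Gst c a i j : atlas c ->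
  smooth_in (cylinder (chart_img c) a) (fun y => Gst c y i j).
Proof.
move=> ac; have := smooth_st_fst (@chart_img_open _ _ _ c) (smooth_pull_metric g i j ac) (s := a).
exact.
Qed.

Lemma posdef_Gst c a y : atlas c -> cylinder (chart_img c) a y -> posdef (Gst c y).
Proof. by move=> ac [Oy _]; exact: posdef_pull_metric. Qed.

Lemma smooth_after_slice a Phi t c : smooth_after a Phi -> a < t -> atlas c ->
  smooth_in (chart_img c) (Phi t \o chart_inv c).
Proof.
move=> sPhi at_ ac.
have sub : chart_img c `<=` [set z | cylinder (chart_img c) a (z, t)] by move=> z Oz; split.
exact: (smooth_in_sub sub (smooth_slice (t := t) (sPhi c ac))).
Qed.

(** At positive times the local extension coincides with [u] on an open set, so smoothness up to the
    boundary becomes smoothness. *)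
Lemma smooth_spacetime_after u : smooth_spacetime u -> smooth_after 0 u.
Proof.
move=> su c ac s [z t] Uzt.
have [|U0 [F [oU0 U0x sF FE]]] := su c ac (z, t).
  by case: Uzt => Oz t0; split=> //; exact: ltW.
have oU1 : open (U0 `&` cylinder (chart_img c) 0).
  by apply: openI => //; apply: open_cylinder; exact: chart_img_open.
have sF1 : smooth_in (U0 `&` cylinder (chart_img c) 0) F.
  by apply: smooth_in_sub sF => y [].
apply: (eq_on_smooth oU1 _ sF1) => // y [Uy [Oy y0]]; apply: FE; split => //.
by split => //; exact: ltW.
Qed.

Lemma derive_time_pull a Phi c z t l : smooth_after a Phi -> atlas c ->
  chart_img c z -> a < t -> 0 < t -> is_time_derive (Phi ^~ (chart_inv c z)) t l ->
  'D_td (pull c Phi) (z, t) = l.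
Proof.
move=> sPhi ac Oz at_ t0 dl.
have [-> dS] := derive_time_slice (pull c Phi) z t.
apply: is_time_derive_unique => //; apply: dS.
by apply: smooth_in_derivable (sPhi c ac) _; split.
Qed.

(** [H] may be any function agreeing with [Phi] on [A] only; at the initial time it is the extension
    provided by [smooth_upto]. *)
Lemma continuous_pull c (H : VT -> R) Phi p t (A : set (R * M)) : chart_dom c p ->
  {for (chart_map c p, t), continuous H} ->
  (\forall y \near (chart_map c p, t), chart_img c y.1 -> A (y.2, chart_inv c y.1) ->
     H y = pull c Phi y) -> A (t, p) ->
  Phi x.1 x.2 @[x --> within A (nbhs (t, p))] --> Phi t p.
Proof.
move=> dp cH nH Atp.
pose m (x : R * M) := (chart_map c x.2, x.1).
have cm : {for p, continuous (chart_map c)}.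
  have := chart_map_continuous (c := c).
  rewrite continuous_open_subspace; last exact: chart_dom_open.
  by apply; rewrite inE.
have cmm : {for (t, p), continuous m}.
  apply: continuous_pair; last exact: cvg_fst.
  by apply: (@continuous_comp _ _ _ snd (chart_map c) (t, p)) => //; exact: cvg_snd.
have E0 : H (chart_map c p, t) = Phi t p.
  have := nbhs_singleton nH; rewrite /pull /= chart_mapK //; apply => //.
  exact: chart_img_map.
have c1 : H (m x) @[x --> (t, p)] --> Phi t p.
  by rewrite -E0; exact: (@continuous_comp _ _ _ m H (t, p) cmm cH).
have nd : \forall x \near (t, p), chart_dom c x.2.
  have ns : x.2 @[x --> (t, p)] --> p by exact: cvg_snd.
  by apply: ns; apply: open_nbhs_nbhs; split => //; exact: chart_dom_open.
have c2 : H (m x) @[x --> within A (nbhs (t, p))] --> Phi t p by exact: cvg_within_filter.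
apply: cvg_trans c2; apply: near_eq_cvg.
have nm : \forall x \near (t, p), chart_img c (m x).1 ->
  A ((m x).2, chart_inv c (m x).1) -> H (m x) = pull c Phi (m x) := cmm _ nH.
rewrite near_withinE; near=> x => Ax.
have dx : chart_dom c x.2 by near: x.
have -> : H (m x) = pull c Phi (m x).
  have nmx : chart_img c (m x).1 -> A ((m x).2, chart_inv c (m x).1) ->
    H (m x) = pull c Phi (m x) by near: x.
  apply: nmx; first exact: chart_img_map.
  by rewrite /m /= chart_mapK // -surjective_pairing.
by rewrite /pull /m /= chart_mapK.
Unshelve. all: by end_near. Qed.

(** A differential inequality then has to be contradicted only where [Phi] is positive and spatially
    critical, in a single chart. The strict sign in time comes from the penalty in
    [compact_time_max]. *)
Lemma spacetime_max a b Phi : compact [set: M] ->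
  smooth_after a Phi ->
  {within `[a, b]%classic `*` [set: M], continuous (fun x : R * M => Phi x.1 x.2)} ->
  (forall p, Phi a p <= 0) -> forall t p, a <= t <= b -> 0 < Phi t p ->
  exists c z t1, [/\ atlas c, chart_img c z, a < t1 <= b &
   [/\ 0 < Phi t1 (chart_inv c z), 0 < 'D_td (pull c Phi) (z, t1),
     forall i, 'D_(fr i) (pull c Phi) (z, t1) = 0 &
     llap fr (Gst c) (pull c Phi) (z, t1) <= 0]].
Proof.
move=> cM sPhi cPhi Phi0 t p tab Pt.
have [eps [t1 [p1 [e0 /andP[at1 t1b] P1 max1]]]] := compact_time_max cM cPhi Phi0 tab Pt.
pose c := chart_at p1; have ac := chart_at_atlas p1; have dc := chart_at_dom p1.
pose z := chart_map c p1; have Oz : chart_img c z := chart_img_map dc.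
have ez : chart_inv c z = p1 by rewrite /z chart_mapK.
have sz := smooth_after_slice sPhi at1 ac.
have mz y : (Phi t1 \o chart_inv c) y <= (Phi t1 \o chart_inv c) z.
  have := max1 t1 (chart_inv c y); rewrite /= ez lerD2r; apply.
  by rewrite (ltW at1).
have nz : \forall y \near z, (Phi t1 \o chart_inv c) y <= (Phi t1 \o chart_inv c) z.
  exact: (@filterE _ (nbhs z) (nbhs_filter z) _ mz).
have [D0 L0] := llap_max_le0 (@chart_img_open _ _ _ c)
  (fun i j => smooth_pull_metric g i j ac) (fun z => @posdef_pull_metric _ _ _ g c z ac) sz Oz nz.
exists c, z, t1; split; [exact: ac|exact: Oz|by rewrite at1|].
split; first by rewrite ez; exact: P1.
- apply: (lt_le_trans e0).
  have [-> dS] := derive_time_slice (pull c Phi) z t1.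
  apply: (derive_ge_at_left_max at1).
    by apply: dS; apply: smooth_in_derivable (sPhi c ac) _; split.
  move=> s /andP[as_ st1]; rewrite /pull /= ez; apply: max1.
  by rewrite (ltW as_) (le_trans st1).
- by move=> i; rewrite derive_sliceE; exact: D0.
- by rewrite llap_st.
Qed.

Lemma smooth_afterW a b Phi : a <= b -> smooth_after a Phi -> smooth_after b Phi.
Proof.
move=> ab sPhi c ac; apply: smooth_in_sub (sPhi c ac) => y [Oy yb]; split=> //.
exact: le_lt_trans yb.
Qed.

End SpaceTimeFunctions.

Lemma derive_subC (R : realType) (V : normedModType R) (f : V -> R) (a : R) x v :
  'D_v (fun y => f y - a) x = 'D_v f x.
Proof.
rewrite /derive.
set g1 := fun h => h^-1 *: _; set g2 := fun h => h^-1 *: _.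
suff -> : g1 = g2 by [].
by rewrite funeqE /g1 /g2 => h /=; rewrite opprB addrA subrK.
Qed.

Lemma llap_subC (R : realType) (V : normedModType R) n (e : 'I_n -> V) G (f : V -> R) (a : R) :
  llap e G (fun y => f y - a) = llap e G f.
Proof.
have E : lgrad e G (fun y => f y - a) = lgrad e G f.
  apply/funext => i; apply/funext => x; rewrite /lgrad.
  by under eq_bigr => j _ do rewrite (derive_subC f a).
by rewrite /llap E.
Qed.

Lemma llap_eq_on (R : realType) (V : normedModType R) n (e : 'I_n -> V) (G : V -> 'M[R]_n)
    (U : set V) (f h : V -> R) x : open U -> (forall y, U y -> f y = h y) -> U x ->
  llap e G f x = llap e G h x.
Proof.
move=> Uo fh Ux; have E i y : U y -> lgrad e G f i y = lgrad e G h i y.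
  move=> Uy; rewrite /lgrad.
  by under eq_bigr => j _ do rewrite (eq_on_derive Uo (e j) fh Uy).
exact: (ldiv_eq_on e G Uo E Ux).
Qed.

(* With x = 2 K t / 5, this follows from exp (- 5 x) >= (1 - x)^5. *)
Lemma ricci_coef_ge (R : realType) (K t : R) : 0 <= K -> 0 < t ->
  5 / 2 + 2 * K * t <= t * ricci_coef K t.
Proof.
move=> K0 t0; rewrite /ricci_coef; have [->|KN0] := eqVneq K 0.
  by rewrite le_eqVlt; apply/orP; left; apply/eqP; field; rewrite gt_eqF.
have Kt : 0 < K * t by rewrite mulr_gt0 // lt0r KN0.
pose x := 2 * K * t / 5.
have x0 : 0 < x by rewrite /x divr_gt0 // -mulrA mulr_gt0.
have ex : - 2 * K * t = (- x) * 5%:R by rewrite /x; field.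
rewrite ex expRM_natr; set E := expR (- x).
have E1 : E < 1 by rewrite expR_lt1 oppr_lt0.
have E0 : 0 < E by exact: expR_gt0.
have Ex : 1 - x <= E by exact: expR_ge1Dx.
have E51 : E ^+ 5 < 1 by rewrite exprn_ilt1 // ltW.
rewrite mulrA ler_pdivlMr ?subr_gt0 //.
have -> : t * (5 * K) = 25 / 2 * x by rewrite /x; field.
have -> : 5 / 2 + 2 * K * t = 5 / 2 * (1 + 2 * x) by rewrite /x; field.
(* For [x > 1] a crude estimate suffices: [1 + 2 x <= 5 x] and [1 - E^5 < 1]. *)
have [x1|x1] := leP x 1; last first.
  have := exprn_gt0 5 E0; nra.
have P : (1 - x) ^+ 5 <= E ^+ 5 by rewrite lerXn2r ?nnegrE ?subr_ge0 // ltW.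
(* With [y = 5 x = 2 K t], five is the least exponent [m] for which the lower bound [(1 - y / m)^m]
   of [exp (- y)] is sufficient near 0: the terms of order two cancel, which leaves the factor
   [x^3]. *)
have Q : (1 + 2 * x) * (1 - (1 - x) ^+ 5) <= 5 * x.
  rewrite -subr_ge0.
  have -> : 5 * x - (1 + 2 * x) * (1 - (1 - x) ^+ 5) =
    x ^+ 3 * (2 + (1 - x) * (8 - 7 * x + 2 * x ^+ 2)) by ring.
  rewrite mulr_ge0 ?exprn_ge0 ?(ltW x0) // addr_ge0 // mulr_ge0 ?subr_ge0 //.
  by nra.
have EQ : (1 + 2 * x) * (1 - E ^+ 5) <= (1 + 2 * x) * (1 - (1 - x) ^+ 5).
  by rewrite ler_wpM2l ?lerD2l ?lerN2 // addr_ge0 // mulr_ge0 // ltW.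
move: (le_trans EQ Q); rewrite -mulrA; move: (_ * (1 - E ^+ 5)) => u; lra.
Qed.

(** * The Harnack estimate for a positive solution *)

Section Estimate.
Variables (R : realType) (n : nat) (M : manifold R n) (g : riemannian_metric M).
Variables (K0 K1 A : R) (u : R -> M -> R).
Hypotheses (M_compact : compact [set: M]) (K0_ge0 : 0 <= K0).
Hypothesis Ric_bound : ricci_between g (- K0) K1.
Hypothesis u_smooth : smooth_spacetime u.
Hypothesis u_pos : forall t p, 0 <= t -> 0 < u t p.
Hypothesis u_heat : heat_solution g u.
Hypotheses (A_gt0 : 0 < A) (u0_le : forall p, u 0 p <= A).
Local Notation VT := ('rV[R]_n * R)%type.
Local Notation fr := (@frame R n).
Local Notation td := (@time_dir R n).
Local Notation Gst c := (st_metric (pull_metric g c)).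
Local Notation Om c := (cylinder (chart_img c) 0).
Implicit Types (c : chart R n M) (p : M).

Let su : smooth_after 0 u := smooth_spacetime_after u_smooth.
Let Omo c : open (Om c).
Proof. by apply: open_cylinder; exact: chart_img_open. Qed.

Lemma smooth_slice_u t c : 0 < t -> atlas c -> smooth_in (chart_img c) (u t \o chart_inv c).
Proof. exact: smooth_after_slice su. Qed.

Lemma derive_time_u c y : atlas c -> Om c y ->
  'D_td (pull c u) y = laplacian g (u y.2) (chart_inv c y.1).
Proof.
case: y => z t ac [/= Oz t0].
exact: (derive_time_pull su ac Oz t0 t0 (@u_heat t (chart_inv c z) (ltW t0))).
Qed.

Lemma heat_pull c y : atlas c -> Om c y ->
  'D_td (pull c u) y = llap fr (Gst c) (pull c u) y.
Proof.
move=> ac Oy; rewrite (derive_time_u ac Oy); case: y Oy => z t [/= Oz t0].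
by rewrite llap_st (laplacian_inv g ac Oz (fun c' => @smooth_slice_u t c' t0)).
Qed.

Lemma u_le t p : 0 <= t -> u t p <= A.
Proof.
move=> t0; rewrite leNgt; apply/negP => uA.
pose Phi t p := u t p - A.
have sPhi : smooth_after 0 Phi.
  by move=> c ac; exact: (smoothB (@Omo c) (su ac) (smooth_cst (@Omo c) A)).
have cPhi : {within `[0, t]%classic `*` [set: M], continuous (fun x : R * M => Phi x.1 x.2)}.
  apply/subspace_continuousP => -[s q] [/=]; rewrite in_itv /= => /andP[s0 st] _.
  apply: cvgB; last by apply: cvg_cst.
  have ac := chart_at_atlas q; have dc := chart_at_dom q.
  (* Continuity is required down to time 0, where [u] is known from one side only; the local
     extension [F] provides it. *)
  have [|U [F [oU Ux sF FE]]] := u_smooth ac (x := (chart_map (chart_at q) q, s)).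
    by split => //; exact: chart_img_map.
  apply: (continuous_pull dc (smooth_in_continuous sF Ux)); last first.
    by split => //=; rewrite in_itv /= s0.
  have nU : \forall y \near (chart_map (chart_at q) q, s), U y by exact: open_nbhs_nbhs.
  apply: filterS nU => y Uy Oy [/=]; rewrite in_itv /= => /andP[y0 _] _.
  exact: FE.
have Phi0 q : Phi 0 q <= 0 by rewrite subr_le0.
have Pt : 0 < Phi t p by rewrite subr_gt0.
have tt : 0 <= t <= t by rewrite t0 lexx.
have [c [z [t1 [ac Oz /andP[t10 _] [_ Dt _ L]]]]] := spacetime_max g M_compact sPhi cPhi Phi0 tt Pt.
have E : pull c Phi = (fun y => pull c u y - A) by [].
move: Dt L; rewrite E derive_subC llap_subC (heat_pull ac); last by split.
by move=> a b; have := lt_le_trans a b; rewrite ltxx.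
Qed.

Let harnack_coef (s t : R) := 5 / 2 + 2 * K0 * (t - s).

(* The clock is started at time s > 0, so that derivatives are only needed at
   positive times. *)
Definition harnack s t p : R :=
  (t - s) * (laplacian g (u t) p / u t p + gradient_norm2 g (fun q => ln (u t q)) p)
  + (harnack_coef s t * ln (u t p) + (- (ln A * harnack_coef s t) - n%:R)).

Definition log_u c (y : VT) := ln (pull c u y).

Let pu_pos c y : Om c y -> 0 < pull c u y.
Proof. by move=> [_ y0]; apply: u_pos; exact: ltW. Qed.

Lemma smooth_log_u c : atlas c -> smooth_in (Om c) (log_u c).
Proof. by move=> ac; exact: (smooth_ln (@Omo c) (@pu_pos c) (su ac)). Qed.

Lemma smooth_slice_log_u t c : 0 < t -> atlas c ->
  smooth_in (chart_img c) ((fun q => ln (u t q)) \o chart_inv c).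
Proof.
move=> t0 ac; apply: (smooth_ln (@chart_img_open _ _ _ c) _ (smooth_slice_u t0 ac)) => z _.
by apply: u_pos; exact: ltW.
Qed.

(** The global quantity contains [Lap u / u], as does the estimate to be proved, where the local one
    contains [f_t]; the heat equation identifies them. *)
Lemma harnack_pull s c y : atlas c -> Om c y ->
  local_harnack fr td (Gst c) (log_u c) (fun y => y.2 - s) K0 (ln A) y = pull c (harnack s) y.
Proof.
move=> ac Oy; have Oy' := Oy; move: Oy'; case: y Oy => z t Oy [/= Oz t0].
rewrite /local_harnack (derive_ln_in (su ac) (@pu_pos c) td Oy) (derive_time_u ac Oy) lnorm2_st.
rewrite /pull /harnack /= [_^-1 * _]mulrC.
by rewrite (gradient_norm2_inv g ac Oz (fun c' => @smooth_slice_log_u t c' t0)).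
Qed.

Lemma smooth_harnack s : smooth_after 0 (harnack s).
Proof.
move=> c ac; have sT := smooth_time (@chart_img_open _ _ _ c) (a := 0) s.
apply: (eq_on_smooth (@Omo c) (fun y => @harnack_pull s c y ac)).
exact: (smooth_local_harnack fr td (@Omo c) (fun i j => smooth_Gst g i j ac)
  (fun y => @posdef_Gst _ _ _ g c 0 y ac) K0 (ln A) (smooth_log_u ac) sT).
Qed.

Lemma ricci_pull c y : atlas c -> Om c y ->
  - K0 * lnorm2 fr (Gst c) (log_u c) y <=
  \sum_j \sum_k lgrad fr (Gst c) (log_u c) j y * lgrad fr (Gst c) (log_u c) k y *
     lric fr (Gst c) j k y.
Proof.
move=> ac Oy; have [Oz t0] := Oy.
set X := lgrad fr (Gst c) (log_u c).
pose v := \row_i X i y.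
have [dz _] := chart_invP Oz.
have /andP[h _] := Ric_bound ac dz v.
have quad (B : 'M[R]_n) : (v *m B *m v^T) 0 0 = \sum_j \sum_k X j y * X k y * B j k.
  rewrite mxE exchange_big; apply: eq_bigr => k _; rewrite !mxE mulr_suml.
  by apply: eq_bigr => j _; rewrite !mxE; ring.
move: h; rewrite !quad.
have -> : \sum_j \sum_k X j y * X k y * g c (chart_inv c y.1) j k = lnorm2 fr (Gst c) (log_u c) y.
  apply: eq_bigr => j _.
  rewrite -(lower_lgrad fr (fun y => @posdef_Gst _ _ _ g c 0 y ac) (log_u c) j Oy) mulr_suml.
  by apply: eq_bigr => k _; rewrite -/X; ring.
have -> // : \sum_j \sum_k X j y * X k y * ricci g c (chart_inv c y.1) j k =
   \sum_j \sum_k X j y * X k y * lric fr (Gst c) j k y.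
apply: eq_bigr => j _; apply: eq_bigr => k _; rewrite (ricci_inv g j k Oz).
by case: y Oy v quad dz Oz t0 => z t *; rewrite lric_st.
Qed.

Lemma harnack_le0 s t p : 0 < s -> s < t -> harnack s t p <= 0.
Proof.
move=> s0 st; rewrite leNgt; apply/negP => Pt.
have sPhi := smooth_harnack s.
have cPhi : {within `[s, t]%classic `*` [set: M],
    continuous (fun x : R * M => harnack s x.1 x.2)}.
  apply/subspace_continuousP => -[r q] [/=]; rewrite in_itv /= => /andP[sr rt] _.
  have ac := chart_at_atlas q; have dc := chart_at_dom q.
  have r0 : 0 < r := lt_le_trans s0 sr.
  have Oy : Om (chart_at q) (chart_map (chart_at q) q, r).
    by split => //; exact: chart_img_map.
  apply: (continuous_pull dc (smooth_in_continuous (sPhi _ ac) Oy)).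
    by apply: (@filterE _ (nbhs _) (nbhs_filter _)) => y _ _.
  by split => //=; rewrite in_itv /= sr.
(* At the starting time only [- 5 / 2 (ln A - ln u) - n] is left, which is nonpositive by [u_le]. *)
have Phi0 q : harnack s s q <= 0.
  have su0 : 0 < u s q by apply: u_pos; exact: ltW.
  have lu : ln (u s q) <= ln A by rewrite ler_ln ?posrE //; apply: u_le; exact: ltW.
  rewrite /harnack /harnack_coef subrr mul0r mulr0 addr0 add0r addrA.
  have : 0 <= n%:R :> R by exact: ler0n.
  by move: lu; lra.
have tt : s <= t <= t by rewrite (ltW st) lexx.
have [c [z [t1 [ac Oz /andP[st1 _] [H0 Dt D0 L]]]]] :=
  spacetime_max g M_compact (smooth_afterW (ltW s0) sPhi) cPhi Phi0 tt Pt.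
have t10 : 0 < t1 := lt_trans s0 st1.
have Oy : Om c (z, t1) by split.
pose T (y : VT) := y.2 - s.
pose H := local_harnack fr td (Gst c) (log_u c) T K0 (ln A).
have EH y : Om c y -> H y = pull c (harnack s) y by exact: harnack_pull.
have sG i j : smooth_in (Om c) (fun y => Gst c y i j) by exact: smooth_Gst.
have pG y : Om c y -> posdef (Gst c y) by exact: posdef_Gst.
have sT : smooth_in (Om c) T := smooth_time (@chart_img_open _ _ _ c) (a := 0) s.
have DT v y : 'D_v T y = v.2 by have [_ ->] := is_derive_time s y v.
have Dt' : 0 < 'D_td H (z, t1) by rewrite (eq_on_derive (@Omo c) td EH Oy).
have DH i : 'D_(fr i) H (z, t1) = 0 by rewrite (eq_on_derive (@Omo c) (fr i) EH Oy); exact: D0.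
have LH : llap fr (Gst c) H (z, t1) <= 0 by rewrite (llap_eq_on _ _ (@Omo c) EH Oy).
have HH : 0 < H (z, t1) by rewrite EH.
have T0 i y : Om c y -> 'D_(fr i) T y = 0 by rewrite DT.
have heat y : Om c y ->
    'D_td (log_u c) y = llap fr (Gst c) (log_u c) y + lnorm2 fr (Gst c) (log_u c) y.
  move=> Oy'; exact: (heat_ln (@Omo c) sG pG (su ac) (@pu_pos c) (fun y => @heat_pull c y ac) Oy').
have Tx : 0 < T (z, t1) by rewrite subr_gt0.
have DtT : 'D_td T (z, t1) = 1 by rewrite DT.
have la : log_u c (z, t1) <= ln A.
  by rewrite ler_ln ?posrE //; [apply: u_le; exact: ltW|exact: pu_pos].
have := local_harnack_max (@Omo c) sG pG (@tau_invariant_st _ _ _) (smooth_log_u ac) sT T0 heat Oy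
  Tx DtT K0_ge0 la (ricci_pull ac Oy) HH DH LH.
by rewrite leNgt => /negP; apply.
Qed.

Lemma laplacian_le t p : 0 < t ->
  t * (laplacian g (u t) p / u t p) <= n%:R + (5 / 2 + 2 * K0 * t) * ln (A / u t p).
Proof.
move=> t0; have ut : 0 < u t p by apply: u_pos; exact: ltW.
have l0 : 0 <= ln (A / u t p) by apply: ln_ge0; rewrite ler_pdivlMr // mul1r u_le // ltW.
rewrite leNgt; set q := laplacian g (u t) p / u t p; set l := ln _ in l0 *; apply/negP => h.
pose d := t * q - (n%:R + (5 / 2 + 2 * K0 * t) * l).
have d0 : 0 < d by rewrite subr_gt0.
have N0 : 0 < 2 * (`|q| + 1) by rewrite mulr_gt0 //; have := normr_ge0 q; lra.
(* If the estimate fails by [d], then [harnack s t p] is at least [d - s q]; the second bound on [s]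
   keeps [s q] below [d], and the summand 1 allows for [q = 0]. This explicit choice replaces a
   limit [s -> 0]. *)
pose s := Num.min (t / 2) (d / (2 * (`|q| + 1))).
have s0 : 0 < s by rewrite lt_min !divr_gt0.
have st : s < t.
  by rewrite (@le_lt_trans _ _ (t / 2)) ?ge_min ?lexx // ltr_pdivrMr // ltr_pMr // ltr1n.
have := harnack_le0 p s0 st; rewrite /harnack -/q.
have W0 : 0 <= gradient_norm2 g (fun q => ln (u t q)) p.
  apply: (lnorm2_ge0 _ (fun z => @posdef_pull_metric _ _ _ g _ z (chart_at_atlas p))).
  exact/chart_img_map/chart_at_dom.
have el : l = ln A - ln (u t p) by rewrite /l ln_div ?posrE.
have sq : s * q < d.
  have sd : s * (2 * (`|q| + 1)) <= d by rewrite -ler_pdivlMr // ge_min lexx orbT.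
  have sn : s * q <= s * `|q| by rewrite ler_wpM2l ?ler_norm // ltW.
  have : 0 <= s * `|q| by rewrite mulr_ge0 // ltW.
  move: sn; move: (s * q) => sq' ; move: sd; rewrite mulrCA mulrDr mulr1; lra.
have ts : 0 <= (t - s) * gradient_norm2 g (fun q => ln (u t q)) p.
  by rewrite mulr_ge0 // subr_ge0 ltW.
have Ksl : 0 <= K0 * s * l by rewrite !mulr_ge0 // ltW.
rewrite mulrDr /harnack_coef leNgt => /negP; apply.
have -> : (t - s) * q + (t - s) * gradient_norm2 g (fun q0 => ln (u t q0)) p +
 ((5 / 2 + 2 * K0 * (t - s)) * ln (u t p) +
  (- (ln A * (5 / 2 + 2 * K0 * (t - s))) - n%:R)) =
  d - s * q + (t - s) * gradient_norm2 g (fun q0 => ln (u t q0)) p + 2 * (K0 * s * l).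
  by rewrite /d el; ring.
lra.
Qed.

End Estimate.

Theorem theorem1 (R : realType) (n : nat) (M : manifold R n)
    (g : riemannian_metric M) (K0 K1 A : R) (u : R -> M -> R)
    (M_compact : compact [set: M]) (M_connected : connected [set: M])
    (K0_ge0 : 0 <= K0) (K1_ge0 : 0 <= K1)
    (Ric_bound : ricci_between g (- K0) K1)
    (u_smooth : smooth_spacetime u)
    (u_pos : forall t p, 0 <= t -> 0 < u t p)
    (u_heat : heat_solution g u)
    (A_gt0 : 0 < A)
    (u0_le : forall p, u 0 p <= A) :
  forall t p, 0 < t ->
    laplacian g (u t) p / u t p <=
      n%:R / t + (ricci_coef K0 t + 2 * K1) * ln (A / u t p).
Proof.
move=> t p t0.
have l0 : 0 <= ln (A / u t p).
  apply: ln_ge0; rewrite ler_pdivlMr ?mul1r; last exact/u_pos/ltW.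
  exact: (u_le M_compact u_smooth u_heat u0_le p (ltW t0)).
rewrite -(ler_pM2l t0).
apply: (le_trans (laplacian_le M_compact K0_ge0 Ric_bound u_smooth u_pos u_heat A_gt0 u0_le p t0)).
have -> : t * (n%:R / t + (ricci_coef K0 t + 2 * K1) * ln (A / u t p)) =
   n%:R + (t * ricci_coef K0 t) * ln (A / u t p) + t * (2 * K1 * ln (A / u t p)).
  by field; rewrite gt_eqF.
rewrite -[leLHS]addr0; apply: lerD; last by rewrite !mulr_ge0 // ltW.
by rewrite lerD2l ler_wpM2r // ricci_coef_ge.
Qed.
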